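(* There is a deterministic algorithm that, given a directed graph $G$ with $n$ vertices and $m$ edges (as adjacency lists) and an integer $k\le n$, such that the number of $k$-paths in $G$ is $0$ or $1$, decides whether $G$ contains a $k$-path, in time $2^k(n+m)\operatorname{poly}(k)$.
   Context: A $k$-path in $G$ is a sequence $w_1,\dots,w_k$ of pairwise distinct vertices with $w_iw_{i+1}\in E(G)$ for all $i\in\{1,\dots,k-1\}$. Running time is in the word-RAM model with words in $\{-n,\dots,n\}$.
   Formalization: Words range over {-W,...,W} with W=(n+m+4)^e for a constant e (words of O(log n) bits) instead of {-n,...,n}, since words bounded by n cannot address the n+m cells of the input; the time bound is stated as C 2^k (n+m+1)(k+1)^d. *)

(* Defs.v *)
From Stdlib Require Import ZArith.
From mathcomp Require Import all_boot.
Set Implicit Arguments. Unset Strict Implicit. Unset Printing Implicit Defensive.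

Definition adj_wf (n : nat) (adj : seq (seq nat)) : bool :=
  (size adj == n) && all (fun l => uniq l && all (fun v => v < n) l) adj.

Definition num_edges (adj : seq (seq nat)) : nat := sumn (map size adj).

Definition is_edge (adj : seq (seq nat)) (u v : nat) : bool :=
  v \in nth [::] adj u.

Definition is_kpath (n k : nat) (adj : seq (seq nat)) (w : k.-tuple 'I_n) : bool :=
  uniq w &&
  [forall i : 'I_k, (i.+1 < k) ==>
      is_edge adj (nth 0 (map val w) i) (nth 0 (map val w) i.+1)].

Definition num_kpaths (n k : nat) (adj : seq (seq nat)) : nat :=
  #|[set w : k.-tuple 'I_n | is_kpath adj w]|.

Definition has_kpath (n k : nat) (adj : seq (seq nat)) : bool :=
  [exists w : k.-tuple 'I_n, is_kpath adj w].

(* A deterministic word-RAM.                                           *)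
(* Memory is an array of integer cells indexed by nat; cells with      *)
(* small fixed index play the role of registers. Every instruction     *)
(* costs one time unit. Every value ever stored (hence every address)  *)
(* must lie in [-W, W]; otherwise the machine faults (no output).      *)

Inductive instr : Type :=
| IConst (d : nat) (c : Z)
| IAdd   (d a b : nat)
| ISub   (d a b : nat)
| IMul   (d a b : nat)
| IDiv   (d a b : nat)
| IMod   (d a b : nat)
| IAnd   (d a b : nat)
| IOr    (d a b : nat)
| IXor   (d a b : nat)
| ILt    (d a b : nat)
| ILoad  (d a : nat)
| IStore (a s : nat)
| IJz    (r l : nat)
| IHalt.

Record config := Config { pc : nat; mem : nat -> Z }.

Definition in_word (W : Z) (x : Z) : bool := (- W <=? x)%Z && (x <=? W)%Z.

Definition upd (M : nat -> Z) (d : nat) (x : Z) : nat -> Z :=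
  fun i => if i == d then x else M i.

Definition step (W : Z) (P : seq instr) (c : config) : option config :=
  let M := mem c in
  let write d x :=
    if in_word W x then Some (Config (pc c).+1 (upd M d x)) else None in
  if pc c < size P then
      match nth IHalt P (pc c) with
      | IConst d x => write d x
      | IAdd d a b => write d (M a + M b)%Z
      | ISub d a b => write d (M a - M b)%Z
      | IMul d a b => write d (M a * M b)%Z
      | IDiv d a b => if (M b =? 0)%Z then None else write d (M a / M b)%Z
      | IMod d a b => if (M b =? 0)%Z then None else write d (Z.modulo (M a) (M b))
      | IAnd d a b => write d (Z.land (M a) (M b))
      | IOr  d a b => write d (Z.lor (M a) (M b))
      | IXor d a b => write d (Z.lxor (M a) (M b))
      | ILt  d a b => write d (if (M a <? M b)%Z then 1%Z else 0%Z)
      | ILoad d a => if (0 <=? M a)%Z then write d (M (Z.to_nat (M a))) else None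
      | IStore a s => if (0 <=? M a)%Z then write (Z.to_nat (M a)) (M s) else None
      | IJz r l => Some (Config (if (M r =? 0)%Z then l else (pc c).+1) M)
      | IHalt => Some c
      end
  else None.

Fixpoint run (W : Z) (P : seq instr) (t : nat) (c : config) : option config :=
  match t with
  | 0 => Some c
  | t'.+1 => match step W P c with
             | Some c' => run W P t' c'
             | None => None
             end
  end.

Definition halted (P : seq instr) (c : config) : bool :=
  (pc c < size P) && (if nth IHalt P (pc c) is IHalt then true else false).

(* Input encoding (adjacency lists in compressed form):
     M[0] = n, M[1] = m, M[2] = k,
     M[3 + v] = start index of the list of v in the target array (v <= n),
     M[4 + n + j] = j-th entry of the concatenation of the lists,
   all other cells 0. Execution starts at pc = 0. *)
Definition input_mem (n k : nat) (adj : seq (seq nat)) : nat -> Z :=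
  let m := num_edges adj in
  let tg := flatten adj in
  fun i =>
    if i == 0 then Z.of_nat n
    else if i == 1 then Z.of_nat m
    else if i == 2 then Z.of_nat k
    else if (3 <= i) && (i <= 3 + n) then
      Z.of_nat (sumn (map size (take (i - 3) adj)))
    else if (4 + n <= i) && (i < 4 + n + m) then
      Z.of_nat (nth 0 tg (i - (4 + n)))
    else 0%Z.

Definition decides_within (W : Z) (P : seq instr) (n k : nat)
    (adj : seq (seq nat)) (ans : bool) (T : nat) : Prop :=
  exists t, t <= T /\
    exists c, run W P t (Config 0 (input_mem n k adj)) = Some c /\
      halted P c /\ mem c 0 = (if ans then 1%Z else 0%Z).

(* Main.v *)
(* Give vertex v the binary polynomial a_v in F_2[x] of its number, and the
   vector (1, a_v, ..., a_v^(k-1)).  Modulo 2 the determinant of k such vectors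
   is a permanent, so Ryser's formula writes the sum, over all k-walks, of the
   Vandermonde determinants of their vertices as
     sum_(S <= [k]) sum_(walks w) prod_i (sum_(j in S) a_(w_i)^j).
   Walks with a repeated vertex contribute 0 and the unique k-path, if any,
   contributes a nonzero product of differences.  For fixed S the inner sum is
   computed by dynamic programming over the edges in space polynomial in n + m
   (a table indexed by the subsets S would not fit in the address space), and S
   runs through a k-bit counter stored in an array.

   Polynomials have degree O(k^2 log n) and are stored as 2k^2 + 1 limbs of s
   bits, with 2^s about sqrt n: products of limbs then come from a table of O(n)
   entries, so that multiplying by a_v (two limbs) takes O(k^2) steps.
   Everything is computed modulo X^(s (2k^2 + 1)), which exceeds the degree of
   the final sum. *)
Require Import Defs.
From Stdlib Require Import ZArith Lia.
From mathcomp Require Import all_boot all_fingroup all_algebra zify ring.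
Delimit Scope Z_scope with Z.
Set Implicit Arguments. Unset Strict Implicit. Unset Printing Implicit Defensive.
Import GRing.Theory.

(** * Inclusion-exclusion in characteristic two *)

(** Working in F_2[x] itself rather than in a finite field means that no irreducible polynomial has
    to be found and nothing has to be reduced; distinct vertex numbers are distinct elements, and an
    integral domain is all that the nonvanishing of a Vandermonde product needs. The price is
    truncation: limbs beyond a fixed number are dropped, so every computed value is known only up to
    congruence. A degree bound is proved for the final Vandermonde product alone, where congruence
    to the result becomes equivalence of being zero; intermediate values need none. The machine
    imposes the rest. It has no carry-less product, hence the table, and it faults on any oversized
    value, so range conditions accompany every operation. Its input lies in the very cells that
    serve as registers, so part of it has to be moved before anything else. To keep these matters
    apart from the algebra, the algorithm is written in a small while language whose executions
    carry exact instruction counts and imply the absence of faults; a compiler preserves both, and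
    the time analysis takes place on the source program. *)

Section CharTwo.
Local Open Scope ring_scope.
Variable R : comNzRingType.
Hypothesis R2 : 2%N \in [pchar R].

Lemma prodr_bool (I : finType) (P : pred I) :
  \prod_(i : I) (P i)%:R = [forall i, P i]%:R :> R.
Proof.
case: forallP => [H|/forallP]; first by rewrite big1 // => i _; rewrite H.
rewrite negb_forall => /existsP[i /negbTE Hi].
by rewrite (bigD1 i) //= Hi mul0r.
Qed.

(* The number of indicator vectors containing the image of h is
   2^(k - #|im h|), which is odd exactly when h is onto. *)
Lemma sum_indicators (k : nat) (h : {ffun 'I_k -> 'I_k}) :
  \sum_(b : {ffun 'I_k -> bool}) \prod_(i < k) (b (h i))%:R
    = (injectiveb h)%:R :> R.
Proof.
have E (b : {ffun 'I_k -> bool}) : true -> \prod_(i < k) (b (h i))%:R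
    = \prod_(j < k) ((j \in codom h) ==> b j)%:R :> R.
  move=> _; rewrite !prodr_bool; congr ((_ : bool)%:R).
  apply/forallP/forallP => H i; last by have := H (h i); rewrite codom_f.
  by apply/implyP => /codomP[x ->].
rewrite (eq_bigr _ E) -(bigA_distr_bigA (fun j x => ((j \in codom h) ==> x)%:R)) /=.
have E2 j : true -> \sum_(x : bool) ((j \in codom h) ==> x)%:R
    = (j \in codom h)%:R :> R.
  move=> _; rewrite big_bool /=; case: (_ \in _) => /=; first by rewrite addr0.
  exact: addrr_pchar2.
rewrite (eq_bigr _ E2) prodr_bool; congr ((_ : bool)%:R).
apply/forallP/idP => [H|/injectiveP H j]; last first.
  exact: (inj_card_onto H).
apply/injectiveP => i j; apply: (image_injP (A := predT) _) => //.
by rewrite (eq_card (B := predT)) // => x; exact: H.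
Qed.

Lemma det_pchar2 (k : nat) (A : 'M[R]_k) :
  \det A = \sum_(s : 'S_k) \prod_(i < k) A i (s i).
Proof.
apply: eq_bigr => s _; case: (odd_perm s); last by rewrite expr0 mul1r.
by rewrite expr1 (oppr_pchar2 R2) mul1r.
Qed.

Lemma sum_injective_ffun (k : nat) (F : ('I_k -> 'I_k) -> R) :
  (forall f g, f =1 g -> F f = F g) ->
  \sum_(h : {ffun 'I_k -> 'I_k} | injectiveb h) F h = \sum_(s : 'S_k) F s.
Proof.
move=> FE; rewrite (reindex_onto (@pval _) (insubd (1%g : 'S_k))) /=; last first.
  by move=> h hP; rewrite insubdK.
apply: eq_big => [s|s _]; last by apply: FE => i; rewrite pvalE.
by rewrite valKd eqxx andbT; apply/injectiveP; rewrite pvalE; exact: perm_inj.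
Qed.

(** Expanding the product picks one index [h i] per factor. After the two sums are exchanged, the
    coefficient of [h] is the sum of [sum_indicators], so only the bijections survive and the
    permanent remains. *)
Lemma sum_indicator_det (k : nat) (a : 'I_k -> 'I_k -> R) :
  \sum_(b : {ffun 'I_k -> bool}) \prod_(i < k) \sum_(j < k) (b j)%:R * a i j
    = \det (\matrix_(i, j) a i j).
Proof.
under eq_bigr => b _ do rewrite bigA_distr_bigA /=.
rewrite exchange_big /=.
under eq_bigr => h _.
  under eq_bigr => b _ do rewrite big_split /=.
  rewrite -mulr_suml sum_indicators mulr_natl mulrb; over.
rewrite -big_mkcond /= (sum_injective_ffun (F := fun h => \prod_i a i (h i))).
  rewrite det_pchar2; apply: eq_bigr => s _.
  by apply: eq_bigr => i _; rewrite mxE.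
by move=> f g fg; apply: eq_bigr => i _; rewrite fg.
Qed.

Lemma sum_indicator_Vandermonde (k : nat) (x : 'I_k -> R) :
  \sum_(b : {ffun 'I_k -> bool}) \prod_(i < k) \sum_(j < k) (b j)%:R * x i ^+ j
    = \prod_(i < k) \prod_(j < k | (i < j)%N) (x j + x i).
Proof.
rewrite (sum_indicator_det (fun i j => x i ^+ j)).
rewrite -det_tr; have -> : (\matrix_(i < k, j < k) x i ^+ j)^T
    = Vandermonde k (\row_i x i).
  by apply/matrixP => i j; rewrite !mxE.
rewrite det_Vandermonde; apply: eq_bigr => i _; apply: eq_bigr => j _.
by rewrite !mxE (oppr_pchar2 R2).
Qed.

End CharTwo.

(** * Weighted sums over walks *)

Section Walks.
Local Open Scope ring_scope.
Variable R : comNzRingType.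
Variables (n : nat) (adj : seq (seq nat)).
Hypothesis adjP : adj_wf n adj.

(** The start vertex carries no weight, so one unfolding is exactly one step of the dynamic program:
    weigh every vertex, then sum over out-neighbours. *)
Fixpoint walk_sum (c : nat -> R) (t v : nat) : R :=
  if t is t'.+1 then \sum_(u <- nth [::] adj v) c u * walk_sum c t' u else 1.

Lemma uniq_adj v : uniq (nth [::] adj v).
Proof.
case/andP: adjP => _ /allP H; case: (ltnP v (size adj)) => vn.
  by case/andP: (H _ (mem_nth [::] vn)).
by rewrite nth_default.
Qed.

Lemma adj_lt v u : u \in nth [::] adj v -> (u < n)%N.
Proof.
case/andP: adjP => _ /allP H; case: (ltnP v (size adj)) => vn.
  by case/andP: (H _ (mem_nth [::] vn)) => _ /allP; apply.
by rewrite nth_default.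
Qed.

(** Adjacency lists are duplicate-free, so each edge is counted once; in characteristic two a
    repeated entry would cancel. *)
Lemma sum_adj (F : nat -> R) v :
  \sum_(u <- nth [::] adj v) F u = \sum_(u < n | is_edge adj v u) F u.
Proof.
rewrite -(big_mkord (is_edge adj v)) -big_filter; apply: perm_big.
apply: uniq_perm; rewrite ?uniq_adj ?filter_uniq ?iota_uniq //.
move=> u; rewrite mem_filter mem_index_iota /= /is_edge.
by case E: (_ \in _) => //; rewrite (adj_lt E).
Qed.

Lemma sum_tuple_cons t (P : pred (seq 'I_n)) (F : seq 'I_n -> R) :
  \sum_(w : t.+1.-tuple 'I_n | P w) F w
  = \sum_(u < n) \sum_(w : t.-tuple 'I_n | P (u :: w)) F (u :: w).
Proof.
rewrite pair_big_dep /=.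
rewrite (reindex (fun p : 'I_n * t.-tuple 'I_n => [tuple of p.1 :: p.2])) //=.
exists (fun w => (thead w, [tuple of behead w])) => [[u w]|w] _ /=.
  by congr (_, _); apply: val_inj.
by rewrite [RHS]tuple_eta; apply: val_inj.
Qed.

Lemma walk_sumE c t (v : nat) :
  walk_sum c t v
  = \sum_(w : t.-tuple 'I_n | path (is_edge adj) v (map val w))
      \prod_(u <- w) c (val u).
Proof.
elim: t v => [|t IH] v /=.
  rewrite (big_pred1 [tuple]) ?big_nil // => w.
  by rewrite (tuple0 w) /= eqxx.
rewrite sum_adj (sum_tuple_cons _ (fun w => path _ v (map val w)) (fun w => \prod_(u <- w) c (val u))).
rewrite [RHS](bigID (fun u : 'I_n => is_edge adj v u)) /= [X in _ + X]big1 ?addr0.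
  apply: eq_bigr => u vu; rewrite IH big_distrr /=.
  by apply: eq_big => [w|w _]; rewrite ?vu ?big_cons.
by move=> u /negbTE vu; rewrite big_pred0 // => w; rewrite vu.
Qed.

Lemma sum_walk_sum (c : nat -> R) t :
  \sum_(v < n) c v * walk_sum c t v
  = \sum_(w : t.+1.-tuple 'I_n | sorted (is_edge adj) (map val w))
      \prod_(i < t.+1) c (tnth w i).
Proof.
under [RHS]eq_bigr => w _ do rewrite -(big_tuple _ _ w xpredT (fun u : 'I_n => c u)).
rewrite (sum_tuple_cons _ (fun w => sorted _ (map val w)) (fun w => \prod_(u <- w) c (val u))).
apply: eq_bigr => v _; rewrite walk_sumE big_distrr /=.
by apply: eq_bigr => w _; rewrite big_cons.
Qed.

Lemma is_kpathE k (w : k.-tuple 'I_n) :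
  is_kpath adj w = uniq w && sorted (is_edge adj) (map val w).
Proof.
congr (_ && _); apply/forallP/(sortedP 0%N) => H i.
  rewrite size_map size_tuple => ik.
  by have := H (Ordinal (ltnW ik)); rewrite /= ik.
by apply/implyP => ik; apply: H; rewrite size_map size_tuple.
Qed.
End Walks.

(** * Detecting a unique k-path by the sieve *)

Section Detect.
Local Open Scope ring_scope.
Variable R : idomainType.
Hypothesis R2 : 2%N \in [pchar R].
Variables (n : nat) (adj : seq (seq nat)) (alpha : nat -> R).
Hypothesis adjP : adj_wf n adj.

Definition vertex_weight k (b : nat -> bool) (v : nat) : R :=
  \sum_(j < k) (b j)%:R * alpha v ^+ j.

Definition path_vandermonde k (w : k.-tuple 'I_n) : R :=
  \prod_(i < k) \prod_(j < k | (i < j)%N) (alpha (tnth w j) + alpha (tnth w i)).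

Lemma path_vandermonde_not_uniq k (w : k.-tuple 'I_n) :
  ~~ uniq w -> path_vandermonde w = 0.
Proof.
move=> wU; suff [i [j [ij E]]] : exists i j : 'I_k, (i < j)%N /\ tnth w i = tnth w j.
  rewrite /path_vandermonde (bigD1 i) //= (bigD1 j) //= E.
  by rewrite (addrr_pchar2 R2) !mul0r.
have [/existsP[i /existsP[j /andP[ij /eqP E]]]|H] :=
    boolP [exists i : 'I_k, [exists j : 'I_k, (i < j)%N && (tnth w i == tnth w j)]].
  by exists i, j.
case/negP: wU; apply/tuple_uniqP => i j E; apply: val_inj => /=.
case: (ltngtP i j) => // ij; case/negP: H; apply/existsP.
  by exists i; apply/existsP; exists j; rewrite ij E /=.
by exists j; apply/existsP; exists i; rewrite ij E /=.
Qed.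

Lemma path_vandermonde_neq0 k (w : k.-tuple 'I_n) :
  {in gtn n &, injective alpha} -> uniq w -> path_vandermonde w != 0.
Proof.
move=> inj /tuple_uniqP wU; apply/prodf_neq0 => i _; apply/prodf_neq0 => j ij.
rewrite -[X in _ + X](oppr_pchar2 R2) subr_eq0; apply/eqP => /inj E.
have /wU ji : tnth w j = tnth w i by apply/val_inj/E; apply: ltn_ord.
by rewrite ji ltnn in ij.
Qed.

Definition weighted_walks k (b : nat -> bool) : R :=
  \sum_(v < n) vertex_weight k b v * walk_sum adj (vertex_weight k b) k.-1 v.

Lemma eq_weighted_walks k (b b' : nat -> bool) :
  (forall j, j < k -> b j = b' j)%N -> weighted_walks k b = weighted_walks k b'.
Proof.
move=> bb'; have E v : vertex_weight k b v = vertex_weight k b' v.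
  by apply: eq_bigr => j _; rewrite bb'.
apply: eq_bigr => v _; rewrite E; congr (_ * _).
elim: k.-1 (v : nat) => //= t IH u; apply: eq_bigr => w _; by rewrite E IH.
Qed.

(** Once the sum over walks is moved outside, the sieve acts on each walk separately and turns it
    into its Vandermonde product, which vanishes unless the walk is a path. *)
Lemma sum_weighted_walks k :
  \sum_(b : {ffun 'I_k.+1 -> bool}) weighted_walks k.+1 (fun j => b (inord j))
  = \sum_(w : k.+1.-tuple 'I_n | is_kpath adj w) path_vandermonde w.
Proof.
under eq_bigr => b _ do rewrite /weighted_walks sum_walk_sum //.
rewrite exchange_big /= [RHS]big_mkcond /= [LHS]big_mkcond /=.
apply: eq_bigr => w _; rewrite is_kpathE andbC; case: (sorted _ _) => //=.
under eq_bigr => b _ do under eq_bigr => i _ do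
  under [vertex_weight _ _ _]eq_bigr => j _ do rewrite inord_val.
rewrite (sum_indicator_Vandermonde R2) -/(path_vandermonde w).
by case: ifP => // /negbT /path_vandermonde_not_uniq.
Qed.

Definition nat_bit (c j : nat) : bool := odd (c %/ 2 ^ j).

Lemma nat_bit_inj k c c' : (c < 2 ^ k)%N -> (c' < 2 ^ k)%N ->
  (forall j, j < k -> nat_bit c j = nat_bit c' j)%N -> c = c'.
Proof.
elim: k c c' => [|k IH] c c'; first by rewrite !ltnS !leqn0 => /eqP-> /eqP->.
rewrite expnSr -!ltn_divLR // => ck c'k H.
rewrite (divn_eq c 2) (divn_eq c' 2) !modn2.
have -> : odd c = odd c' by have := H 0%N isT; rewrite /nat_bit expn0 !divn1.
by rewrite (IH _ _ ck c'k) // => j jk; have := H j.+1 jk; rewrite /nat_bit expnS !divnMA.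
Qed.

(** The machine enumerates subsets as binary numbers, the algebra as indicator functions. Binary
    expansion is injective on numbers below the power of two, hence bijective by cardinality. *)
Lemma sum_nat_bits k (H : (nat -> bool) -> R) :
  (forall b b', (forall j, j < k.+1 -> b j = b' j)%N -> H b = H b') ->
  \sum_(c < 2 ^ k.+1) H (nat_bit c)
    = \sum_(b : {ffun 'I_k.+1 -> bool}) H (fun j => b (inord j)).
Proof.
move=> HE; pose f (c : 'I_(2 ^ k.+1)) := [ffun j : 'I_k.+1 => nat_bit c j].
rewrite (reindex f); last first.
  apply/onW_bij/inj_card_bij; last by rewrite card_ffun card_bool !card_ord.
  move=> c c' /ffunP E; apply/val_inj/(@nat_bit_inj k.+1); rewrite ?ltn_ord // => j jk.
  by have := E (Ordinal jk); rewrite !ffunE.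
by apply: eq_bigr => c _; apply: HE => j jk; rewrite ffunE inordK.
Qed.

Definition sieve k : R := \sum_(0 <= c < 2 ^ k) weighted_walks k (nat_bit c).

(** Two paths could cancel in characteristic two; with at most one, the sum over paths is empty or a
    single product. The length is a successor because a walk needs a first vertex; length 0 is
    settled by [has_kpath0]. *)
Lemma sieve_has_kpath k : (num_kpaths n k.+1 adj <= 1)%N ->
  if has_kpath n k.+1 adj then
    exists2 w : k.+1.-tuple 'I_n, uniq w & sieve k.+1 = path_vandermonde w
  else sieve k.+1 = 0.
Proof.
rewrite /sieve big_mkord (sum_nat_bits (@eq_weighted_walks _)) sum_weighted_walks => le1.
rewrite /has_kpath; case: ifP => [/existsP[w wP]|/existsP nP]; last first.
  by apply: big_pred0 => w; apply/negP => wP; apply: nP; exists w.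
exists w; first by case/andP: wP.
apply: big_pred1 => w'; apply/idP/eqP => [w'P|->//].
by move/card_le1_eqP: le1; apply; rewrite inE.
Qed.

End Detect.

Lemma has_kpath0 n adj : has_kpath n 0 adj.
Proof. by apply/existsP; exists [tuple]; apply/andP; split=> //; apply/forallP => -[]. Qed.

(** * Binary polynomials and their limbs *)

Section BinaryPolynomials.
Local Open Scope ring_scope.

Lemma pchar_polyF2 : 2%N \in [pchar {poly 'F_2}].
Proof. by apply: (rmorph_pchar (@polyC 'F_2)); apply: pchar_Fp. Qed.

Definition bpoly (z : Z) : {poly 'F_2} :=
  \poly_(i < (Z.to_nat (Z.log2 z)).+1) (Z.testbit z (Z.of_nat i))%:R.

Lemma coef_bpoly z i : (0 <= z)%Z -> (bpoly z)`_i = (Z.testbit z (Z.of_nat i))%:R.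
Proof.
move=> z0; rewrite coef_poly ltnS; case: leqP => // iz.
rewrite Z.bits_above_log2 //; move/ltP: iz; have := Z.log2_nonneg z; lia.
Qed.

Lemma bpoly0 : bpoly 0 = 0.
Proof. by apply/polyP => i; rewrite coef_bpoly // Z.bits_0 coef0. Qed.

Lemma bpoly1 : bpoly 1 = 1.
Proof.
by apply/polyP => -[|i]; rewrite coef_bpoly // coef1.
Qed.

Lemma bpoly_lxor a b : (0 <= a)%Z -> (0 <= b)%Z ->
  bpoly (Z.lxor a b) = bpoly a + bpoly b.
Proof.
move=> a0 b0; apply/polyP => i; rewrite coefD !coef_bpoly ?Z.lxor_nonneg //.
by rewrite Z.lxor_spec; do 2!case: Z.testbit; apply: val_inj.
Qed.

(** As [x] stays below bit [s], the integer addition produces no carry and agrees with addition of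
    polynomials. *)
Lemma bpoly_split (s : nat) x y : (0 <= x < 2 ^ Z.of_nat s)%Z -> (0 <= y)%Z ->
  bpoly (x + 2 ^ Z.of_nat s * y) = bpoly x + 'X^s * bpoly y.
Proof.
move=> xs y0; have P : (0 < 2 ^ Z.of_nat s)%Z by lia.
have P0 : (0 <= x + 2 ^ Z.of_nat s * y)%Z by nia.
apply/polyP => i; rewrite coefD coefXnM !coef_bpoly //; last by lia.
have Ex : x = ((x + 2 ^ Z.of_nat s * y) mod 2 ^ Z.of_nat s)%Z.
  by rewrite Z.mul_comm Z.mod_add ?Z.mod_small //; lia.
have Ey : y = ((x + 2 ^ Z.of_nat s * y) / 2 ^ Z.of_nat s)%Z.
  by rewrite Z.mul_comm Z.div_add ?Z.div_small //; lia.
case: ltnP => si.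
  by rewrite addr0 [in RHS]Ex Z.mod_pow2_bits_low //; lia.
rewrite [in X in X%:R + _]Ex Z.mod_pow2_bits_high ?add0r; last by lia.
rewrite [in RHS]Ey Z.div_pow2_bits; try lia.
by congr ((Z.testbit _ _)%:R); lia.
Qed.

Lemma bpoly_double a : (0 <= a)%Z -> bpoly (2 * a) = 'X * bpoly a.
Proof.
by move=> a0; rewrite -{1}(Z.add_0_l (2 * a)) (@bpoly_split 1) // bpoly0 add0r expr1.
Qed.

Lemma bpoly_inj a b : (0 <= a)%Z -> (0 <= b)%Z -> bpoly a = bpoly b -> a = b.
Proof.
move=> a0 b0 E; apply: Z.bits_inj' => i i0.
have := congr1 (fun p : {poly 'F_2} => p`_(Z.to_nat i)) E.
rewrite !coef_bpoly // Z2Nat.id //; by do 2!case: Z.testbit.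
Qed.

Lemma size_bpoly (s : nat) z : (0 <= z < 2 ^ Z.of_nat s)%Z -> (size (bpoly z) <= s)%N.
Proof.
move=> zs; apply/leq_sizeP => i si; rewrite coef_bpoly; last by lia.
case: (Z.eq_dec z 0) => [->|z0]; first by rewrite Z.bits_0.
rewrite Z.bits_above_log2 //; first by lia.
by have [H _] := Z.log2_lt_pow2 z (Z.of_nat s) ltac:(lia); have := H ltac:(lia); lia.
Qed.

Lemma lxor_bound (s : Z) a b : (0 <= s)%Z -> (0 <= a < 2 ^ s)%Z -> (0 <= b < 2 ^ s)%Z ->
  (0 <= Z.lxor a b < 2 ^ s)%Z.
Proof.
move=> s0 Ha Hb; have X0 : (0 <= Z.lxor a b)%Z by rewrite Z.lxor_nonneg; lia.
split=> //; case: (Z.eq_dec (Z.lxor a b) 0) => [->|N0]; first by lia.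
have P x : (0 <= x < 2 ^ s)%Z -> x = 0%Z \/ (Z.log2 x < s)%Z.
  move=> Hx; case: (Z.eq_dec x 0) => [|x0]; [by left | right].
  by apply/Z.log2_lt_pow2; lia.
have := Z.log2_lxor a b ltac:(lia) ltac:(lia).
have [] := P _ Ha; have [] := P _ Hb => Eb Ea; rewrite ?Ea ?Eb ?Z.lxor_0_l ?Z.lxor_0_r; try lia.
by move=> H; apply/Z.log2_lt_pow2; lia.
Qed.

(* Limbs of s bits, starting at position o of an array. *)
Fixpoint bignum (s : nat) (A : Z -> Z) (o : Z) (L : nat) : Z :=
  if L is L'.+1 then
    (bignum s A o L' + 2 ^ Z.of_nat (s * L') * A (o + Z.of_nat L'))%Z
  else 0%Z.

Definition limbs_ok (s : nat) (A : Z -> Z) (o : Z) (L : nat) : Prop :=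
  forall i : nat, (i < L)%N -> (0 <= A (o + Z.of_nat i) < 2 ^ Z.of_nat s)%Z.

Definition limbs (s : nat) (A : Z -> Z) (o : Z) (L : nat) : {poly 'F_2} :=
  \sum_(i < L) 'X^(s * i) * bpoly (A (o + Z.of_nat i)%Z).

Lemma bignum_bound s A o L :
  limbs_ok s A o L ->
  (0 <= bignum s A o L < 2 ^ Z.of_nat (s * L))%Z.
Proof.
elim: L => [|L IH] H /=; first by rewrite muln0.
have /IH : limbs_ok s A o L.
  by move=> i iL; apply: H; lia.
have := H L ltac:(lia); have -> : Z.of_nat (s * L.+1) = (Z.of_nat (s * L) + Z.of_nat s)%Z by lia.
rewrite Z.pow_add_r; try lia; nia.
Qed.

(** The integer [bignum] is never computed by the program. It serves to derive the degree bound and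
    the zero test for a row of limbs from facts about a single integer. *)
Lemma limbsE s A o L :
  limbs_ok s A o L ->
  limbs s A o L = bpoly (bignum s A o L).
Proof.
rewrite /limbs; elim: L => [|L IH] H; first by rewrite big_ord0 bpoly0.
have H' : limbs_ok s A o L.
  by move=> i iL; apply: H; lia.
rewrite big_ord_recr /= IH // bpoly_split //; first exact: bignum_bound.
by have := H L ltac:(lia); lia.
Qed.

Lemma bignum_eq0 s A o L :
  limbs_ok s A o L ->
  bignum s A o L = 0%Z <-> (forall i : nat, (i < L)%N -> A (o + Z.of_nat i)%Z = 0%Z).
Proof.
elim: L => [|L IH] H //=.
have H' : limbs_ok s A o L.
  by move=> i iL; apply: H; lia.
have := bignum_bound H'; have := H L ltac:(lia).
have P : (0 < 2 ^ Z.of_nat (s * L))%Z by lia.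
split=> [E i|E].
  rewrite ltnS leq_eqVlt => /orP[/eqP->|]; first nia.
  by apply: (proj1 (IH H')); nia.
rewrite (E L) // Z.mul_0_r Z.add_0_r; by apply: (proj2 (IH H')) => i iL; apply: E; lia.
Qed.

Lemma size_limbs s A o L :
  limbs_ok s A o L ->
  (size (limbs s A o L) <= s * L)%N.
Proof. by move=> H; rewrite limbsE //; apply/size_bpoly/bignum_bound. Qed.

Lemma limbs_eq0 s A o L :
  limbs_ok s A o L ->
  limbs s A o L = 0 <-> (forall i : nat, (i < L)%N -> A (o + Z.of_nat i)%Z = 0%Z).
Proof.
move=> H; rewrite -(bignum_eq0 H) limbsE //; split=> [|->]; last exact: bpoly0.
by rewrite -bpoly0 => /bpoly_inj; apply; have := bignum_bound H; lia.
Qed.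

Lemma eq_limbs s A B o o' L :
  (forall i : nat, (i < L)%N -> A (o + Z.of_nat i) = B (o' + Z.of_nat i))%Z ->
  limbs s A o L = limbs s B o' L.
Proof. by move=> H; apply: eq_bigr => i _; rewrite H. Qed.

Lemma limbs_lxor s A B C o o' o'' L :
  (forall i : nat, (i < L)%N -> [/\ 0 <= B (o' + Z.of_nat i), 0 <= C (o'' + Z.of_nat i)
    & A (o + Z.of_nat i) = Z.lxor (B (o' + Z.of_nat i)) (C (o'' + Z.of_nat i))])%Z ->
  limbs s A o L = limbs s B o' L + limbs s C o'' L.
Proof.
move=> H; rewrite -big_split; apply: eq_bigr => i _ /=.
by have [B0 C0 ->] := H i (ltn_ord i); rewrite bpoly_lxor // mulrDr.
Qed.

(** Congruence modulo [X^N], with the quotient as explicit witness, so that compatibility with the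
    ring operations is a polynomial identity. *)
Definition eqXn (N : nat) (p q : {poly 'F_2}) : Prop := exists r, p = q + 'X^N * r.

Lemma eqXn_refl N p : eqXn N p p. Proof. by exists 0; rewrite mulr0 addr0. Qed.

Lemma eqXn_trans N p q r : eqXn N p q -> eqXn N q r -> eqXn N p r.
Proof. by move=> [a ->] [b ->]; exists (a + b); ring. Qed.

Lemma eqXnD N p p' q q' : eqXn N p p' -> eqXn N q q' -> eqXn N (p + q) (p' + q').
Proof. by move=> [a ->] [b ->]; exists (a + b); ring. Qed.

Lemma eqXnM N p q q' : eqXn N q q' -> eqXn N (p * q) (p * q').
Proof. by move=> [b ->]; exists (p * b); ring. Qed.

Lemma eqXn_sum (I : eqType) (r : seq I) (F G : I -> {poly 'F_2}) N :
  (forall i, i \in r -> eqXn N (F i) (G i)) ->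
  eqXn N (\sum_(i <- r) F i) (\sum_(i <- r) G i).
Proof.
elim: r => [|x r IH] H; rewrite ?big_nil ?big_cons; first exact: eqXn_refl.
apply: eqXnD; first by apply: H; rewrite mem_head.
by apply: IH => i ir; apply: H; rewrite in_cons ir orbT.
Qed.

(** The difference has size at most [N], whereas a nonzero multiple of [X^N] is larger. Below the
    truncation point a congruence is therefore an equality. *)
Lemma eqXn_eq0 N (p q : {poly 'F_2}) : (size p <= N)%N -> (size q <= N)%N -> eqXn N p q ->
  p = 0 <-> q = 0.
Proof.
move=> sp sq [r E]; suff r0 : r = 0 by rewrite E r0 mulr0 addr0.
apply/eqP/contraT => rN0; have := size_polyD p (- q).
have -> : p - q = 'X^N * r by rewrite E; ring.
rewrite size_polyN mulrC size_mulXn //; have := rN0.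
rewrite -size_poly_gt0 => r0 H; have := leq_trans H (_ : _ <= N)%N.
by rewrite geq_max sp sq -{2}[N]addn0 leq_add2l leqNgt r0 => /(_ isT).
Qed.

(* The limbs of the multiplicand are c 2, c 3, ..., after two zero pads; l and h
   are the low and high halves of their products by the low limb a of the
   multiplier, l' and h' those by its high limb b. *)
Lemma limbs_mul2 s (c l h l' h' N : nat -> {poly 'F_2}) (a b : {poly 'F_2}) L :
  (forall i, l i + 'X^s * h i = a * c i) -> (forall i, l' i + 'X^s * h' i = b * c i) ->
  (forall i : nat, (i < 2)%N -> [/\ h i = 0, l' i = 0 & h' i = 0]) ->
  (forall i, N i = l i.+2 + h i.+1 + (l' i.+1 + h' i)) ->
  eqXn (s * L) (\sum_(i < L) 'X^(s * i) * N i)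
    ((a + 'X^s * b) * \sum_(i < L) 'X^(s * i) * c i.+2).
Proof.
move=> E E' Z NE.
(* The truncated part of the product: the half products that would land on limb positions [L] and
   [L + 1]. *)
exists (- (h L.+1 + l' L.+1 + h' L + 'X^s * h' L.+1)).
elim: L => [|L IH].
  have [_ _ ->] := Z 0%N isT.
  by have [-> -> ->] := Z 1%N isT; rewrite !big_ord0; ring.
rewrite !big_ord_recr /= IH NE mulnSr exprD.
have -> : forall u x y, (a + 'X^s * b) * (u + x * y)
    = (a + 'X^s * b) * u + (x * (a * y) + 'X^s * x * (b * y)) by move=> u x y; ring.
by rewrite -E -E'; ring.
Qed.
Lemma size_prod_bound (I : finType) (P : pred I) (F : I -> {poly 'F_2}) D N :
  (forall i, P i -> size (F i) <= D.+1)%N -> (#|P| <= N)%N ->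
  (size (\prod_(i | P i) F i)%R <= (N * D).+1)%N.
Proof.
move=> FD PN; apply: leq_trans (size_poly_prod_leq _ _) _.
have : (\sum_(i | P i) size (F i) <= #|P| * D.+1)%N.
  by rewrite -sum_nat_const; exact: leq_sum.
have : (#|P| * D <= N * D)%N by rewrite leq_mul2r PN orbT.
by rewrite mulnS; lia.
Qed.

End BinaryPolynomials.

(** * Carry-less multiplication of integers *)

Section IntegerBits.
Local Open Scope Z_scope.
Local Arguments Z.mul : simpl never.

Lemma zpow2_nat j : 2 ^ Z.of_nat j = Z.of_nat (2 ^ j)%N.
Proof.
elim: j => // j IH; rewrite Nat2Z.inj_succ Z.pow_succ_r; last by lia.
by rewrite IH expnS; lia.
Qed.

(** For the least [s] with [4^s > z], the predecessor of [s] gives [4^s <= 4 z]; the extra 4 covers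
    [s = 0]. This keeps the table of limb products linear in [n]. *)
Lemma sqr_pow2_le (s : nat) z : 0 <= z ->
  (forall j : nat, (j < s)%N -> 2 ^ Z.of_nat j * 2 ^ Z.of_nat j <= z) ->
  2 ^ Z.of_nat s * 2 ^ Z.of_nat s <= 4 * z + 4.
Proof.
case: s => [|j] z0 H; first by rewrite Z.pow_0_r; lia.
have := H j (leqnn _); rewrite Nat2Z.inj_succ Z.pow_succ_r; last by lia.
by nia.
Qed.

Lemma b2z_lxor (x y : bool) : Z.lxor (Z.b2z x) (Z.b2z y) = Z.b2z (x (+) y).
Proof. by case: x; case: y. Qed.

Lemma b2z_mul (x y : bool) : Z.b2z x * Z.b2z y = Z.b2z (x && y).
Proof. by case: x; case: y. Qed.

(** Shift-and-xor multiplication along the bits of [b]: multiplication in F_2[x] on binary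
    encodings. *)
Fixpoint clmul_pos (a : Z) (b : positive) : Z :=
  match b with
  | xH => a
  | xO b => 2 * clmul_pos a b
  | xI b => Z.lxor (2 * clmul_pos a b) a
  end.

Definition clmul (a b : Z) : Z := if b is Z.pos p then clmul_pos a p else 0.

Lemma clmul_pos_ge0 a p : 0 <= a -> 0 <= clmul_pos a p.
Proof. by move=> a0; elim: p => [p IH|p IH|] //=; rewrite ?Z.lxor_nonneg; lia. Qed.

Lemma clmul_ge0 a b : 0 <= a -> 0 <= clmul a b.
Proof. by case: b => //= p; exact: clmul_pos_ge0. Qed.

(** The recurrence by which the table is filled, using only arithmetic that the machine offers. *)
Lemma clmul_half a b : 0 <= a -> 0 <= b ->
  clmul a b = Z.lxor (2 * clmul a (b / 2)) (b mod 2 * a).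
Proof.
move=> a0; case: b => [|p|p] // _.
have [q [r [-> Hr]]] : exists q r, Z.pos p = 2 * q + r /\ (r = 0 \/ r = 1) /\ 0 <= q.
  have := Z.div_mod (Z.pos p) 2 ltac:(lia).
  have := Z.mod_pos_bound (Z.pos p) 2 ltac:(lia).
  move: (Z.pos p / 2) (Z.pos p mod 2) => q r Hr E.
  by exists q, r; split=> //; lia.
rewrite -(@Z.div_unique_pos (2 * q + r) 2 q r) -?(@Z.mod_unique_pos (2 * q + r) 2 q r) //; try lia.
case: Hr => -[] -> q0.
- by rewrite Z.mul_0_l Z.lxor_0_r; case: q q0.
- by rewrite Z.mul_1_l; case: q q0.
Qed.

Lemma clmul_double a h : 0 <= h -> clmul a (2 * h) = 2 * clmul a h.
Proof. by case: h. Qed.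

Lemma bpoly_clmul a b : 0 <= a -> 0 <= b -> bpoly (clmul a b) = (bpoly a * bpoly b)%R.
Proof.
move=> a0; case: b => [|p|p] // _; first by rewrite bpoly0 mulr0.
rewrite /clmul; elim: p => [p IH|p IH|].
- rewrite /= bpoly_lxor //; last by have := @clmul_pos_ge0 a p a0; lia.
  rewrite bpoly_double ?IH; last exact: clmul_pos_ge0.
  have -> : Z.pos p~1 = 1 + 2 ^ Z.of_nat 1 * Z.pos p by [].
  rewrite bpoly_split //.
  by rewrite bpoly1 expr1; ring.
- rewrite /= bpoly_double ?IH; last exact: clmul_pos_ge0.
  by rewrite (_ : Z.pos p~0 = 2 * Z.pos p) ?bpoly_double //; ring.
- by rewrite bpoly1 mulr1.
Qed.

Lemma lt_pow_size_bpoly (N : nat) z : 0 <= z -> (size (bpoly z) <= N)%N -> z < 2 ^ Z.of_nat N.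
Proof.
move=> z0 /leq_sizeP H; case: (Z.eq_dec z 0) => [->|zN]; first by lia.
apply/Z.log2_lt_pow2; first by lia.
case: (Z.lt_ge_cases (Z.log2 z) (Z.of_nat N)) => // Nz.
have := H (Z.to_nat (Z.log2 z)) ltac:(lia).
rewrite coef_bpoly // Z2Nat.id ?Z.bit_log2; try lia.
by move/eqP; rewrite oner_eq0.
Qed.

(** Read off from the degree of the product of polynomials. It makes every product of two limbs
    split into exactly two limbs. *)
Lemma clmul_bound (s : nat) a b : 0 <= a < 2 ^ Z.of_nat s -> 0 <= b < 2 ^ Z.of_nat s ->
  0 <= clmul a b < 2 ^ Z.of_nat s * 2 ^ Z.of_nat s.
Proof.
move=> aB bB; split; first by apply: clmul_ge0; lia.
rewrite -Z.pow_add_r -?Nat2Z.inj_add; try lia.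
apply: lt_pow_size_bpoly; first by apply: clmul_ge0; lia.
rewrite bpoly_clmul; try lia.
apply: leq_trans (size_polyMleq _ _) _.
by have := size_bpoly aB; have := size_bpoly bB; lia.
Qed.

Lemma clmul0 a : clmul a 0 = 0. Proof. by []. Qed.
End IntegerBits.

(** * Arithmetic of the running time *)

Section TimeBounds.
Local Open Scope Z_scope.

(** With [L <= 2 K^2] the three summands contribute 1014, 514 and 30, which add up to 1558. *)
Lemma walk_time_bound (n m k L N K : Z) : 0 <= n -> 0 <= m -> 0 <= k ->
  N = n + m + 1 -> K = k + 1 -> 0 <= L <= 2 * (K * K) ->
  n * ((k + 1) * (400 * L + 100) + 114) + (n + m) * (200 * L + 114) + 30
  <= 1558 * (N * (K * K * K)).
Proof.
move=> n0 m0 k0 NE KE LK.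
have K1 : 1 <= K * K * K by nia.
have K2 : K * K <= K * K * K by nia.
have w1 : (k + 1) * (400 * L + 100) + 114 <= 1014 * (K * K * K).
  have -> : k + 1 = K by lia.
  have : K * L <= K * (2 * (K * K)) by apply: Z.mul_le_mono_nonneg_l; lia.
  have : K <= K * K * K by nia.
  by lia.
have w2 : 200 * L + 114 <= 514 * (K * K * K) by lia.
move: (K * K * K) ((k + 1) * (400 * L + 100) + 114) (200 * L + 114) K1 w1 w2 => y u v y1 uy vy.
have a1 : n * u <= n * (1014 * y) by apply: Z.mul_le_mono_nonneg_l; lia.
have a2 : (n + m) * v <= (n + m) * (514 * y) by apply: Z.mul_le_mono_nonneg_l; lia.
have a3 : 0 <= m * y by apply: Z.mul_nonneg_nonneg; lia.
rewrite NE; lia.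
Qed.

(** Origin of the exponent four: the number of limbs supplies [K^2], the loop over the powers of a
    vertex polynomial a third factor [K], and the [k] steps of a walk the fourth. *)
Lemma round_time_bound (n m k L N K w : Z) : 0 <= n -> 0 <= m -> 0 <= k ->
  N = n + m + 1 -> K = k + 1 -> 0 <= L <= 2 * (K * K) ->
  w <= 1558 * (N * (K * K * K)) ->
  200 * (n * L) + k * (w + 14) + n * (200 * L + 40) + k * 80 + 100
  <= 3000 * (N * (K * K * K * K)).
Proof.
move=> n0 m0 k0 NE KE LK wB.
have K2 : K * K <= K * K * K * K by nia.
have K1 : K <= K * K by nia.
have y1 : 1 <= N * (K * K * K) by nia.
have r1 : n * L <= n * (2 * (K * K)) by apply: Z.mul_le_mono_nonneg_l; lia.
have r2 : n * (K * K) <= n * (K * K * K * K) by apply: Z.mul_le_mono_nonneg_l; lia.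
have r3 : k * (w + 14) <= k * (1572 * (N * (K * K * K))) by apply: Z.mul_le_mono_nonneg_l; lia.
have r4 : k * (N * (K * K * K)) = N * (K * K * K * K) - N * (K * K * K) by rewrite KE; ring.
have r5 : n * 1 <= n * (K * K * K * K) by apply: Z.mul_le_mono_nonneg_l; lia.
have r6 : 0 <= m * (K * K * K * K) by apply: Z.mul_nonneg_nonneg; lia.
have r7 : N * (K * K * K * K) = n * (K * K * K * K) + m * (K * K * K * K) + K * K * K * K by rewrite NE; ring.
lia.
Qed.

Lemma total_time_bound (n m k L N K r p q : Z) : 0 <= n -> 0 <= m -> 0 <= k ->
  N = n + m + 1 -> K = k + 1 -> 0 <= L <= 2 * (K * K) ->
  r <= 3000 * (N * (K * K * K * K)) -> 1 <= p -> q <= 4 * n + 4 ->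
  200 * (n + m) + 100 * n + 200 * q + 300 + (p * (r + 5) + 100 * L + 100)
  <= p * 5000 * N * (K * K * K * K).
Proof.
move=> n0 m0 k0 NE KE LK rB p1 qB.
have K2 : K * K <= K * K * K * K by nia.
have K1 : 1 <= K * K by nia.
have NK : N * 1 <= N * (K * K * K * K) by apply: Z.mul_le_mono_nonneg_l; lia.
have NK' : 1 * (K * K * K * K) <= N * (K * K * K * K) by apply: Z.mul_le_mono_nonneg_r; lia.
have a1 : p * (r + 5) <= p * (3005 * (N * (K * K * K * K))).
  by apply: Z.mul_le_mono_nonneg_l; lia.
have a2 : 1 * (N * (K * K * K * K)) <= p * (N * (K * K * K * K)).
  by apply: Z.mul_le_mono_nonneg_r; lia.
lia.
Qed.
End TimeBounds.

(** * A while language with arrays and its compiler *)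

Inductive binop := OAdd | OSub | OMul | ODiv | OMod | OXor | OLt.

Inductive expr :=
| EVar (x : nat)
| ECst (z : Z)
| EBin (o : binop) (e1 e2 : expr)
| EArr (a : nat) (e : expr)
| ERaw (e : expr).

Inductive cmd :=
| CSet (x : nat) (e : expr)
| CPut (a : nat) (e1 e2 : expr)
| CSeq (c1 c2 : cmd)
| CWhile (e : expr) (c : cmd).

(* Cells below 24 are variables, cells 24..31 are temporaries, and entry i of
   array a is the cell X + 8 i + a, where X is kept in variable 3.  Interleaving
   the arrays makes them disjoint without any bound on their lengths. *)
Notation ntemp := 24 (only parsing).
Notation nreg := 32 (only parsing).

Record state := State { var : nat -> Z; arr : nat -> Z -> Z }.

Definition set_var (s : state) (x : nat) (v : Z) : state :=
  State (fun y => if Nat.eqb y x then v else var s y) (arr s).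

Definition set_arr (s : state) (a : nat) (i v : Z) : state :=
  State (var s) (fun b =>
    if Nat.eqb b a then fun j => if Z.eqb j i then v else arr s a j else arr s b).

Section Compiler.
Local Open Scope Z_scope.
Local Arguments Z.add : simpl never.
Local Arguments Z.mul : simpl never.
Local Arguments Z.of_nat : simpl never.
Variables (W X : Z) (raw : Z -> Z).
Hypotheses (XW : X + 8 <= W) (RX : 32 <= X).

Definition in_range (v : Z) : Prop := - W <= v <= W.

Definition binop_val (o : binop) (u v : Z) : Z :=
  match o with
  | OAdd => u + v | OSub => u - v | OMul => u * v | ODiv => u / v
  | OMod => u mod v | OXor => Z.lxor u v | OLt => if u <? v then 1 else 0
  end.

Definition binop_ok (o : binop) (u v : Z) : Prop :=
  match o with
  | ODiv | OMod => v <> 0 /\ in_range (binop_val o u v)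
  | OLt => True
  | _ => in_range (binop_val o u v)
  end.

Fixpoint expr_val (e : expr) (s : state) : Z :=
  match e with
  | EVar x => var s x
  | ECst z => z
  | EBin o e1 e2 => binop_val o (expr_val e1 s) (expr_val e2 s)
  | EArr a e => arr s a (expr_val e s)
  | ERaw e => raw (expr_val e s)
  end.

(** One condition that bounds the address of entry [i] in all eight interleaved arrays. *)
Definition index_ok (i : Z) : Prop := 0 <= i /\ X + 8 * i + 8 <= W.

Fixpoint expr_ok (e : expr) (s : state) : Prop :=
  match e with
  | EVar x => True
  | ECst z => in_range z
  | EBin o e1 e2 =>
      expr_ok e1 s /\ expr_ok e2 s /\ binop_ok o (expr_val e1 s) (expr_val e2 s)
  | EArr a e => expr_ok e s /\ index_ok (expr_val e s)
  | ERaw e => expr_ok e s /\ 32 <= expr_val e s < X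
  end.

(** Expressions compile to straight-line code, so this number is both the length of the code and its
    running time. *)
Fixpoint expr_cost (e : expr) : nat :=
  match e with
  | EVar x => 2
  | ECst z => 1
  | EBin o e1 e2 => expr_cost e1 + expr_cost e2 + 1
  | EArr a e => expr_cost e + 6
  | ERaw e => expr_cost e + 1
  end.

(** A derivation exists only for a terminating run in which no operation leaves the word range, and
    it records the exact number of machine steps. The 3 in a loop iteration are the exit test, the
    loading of 0 and the jump back. *)
Inductive exec : cmd -> state -> nat -> state -> Prop :=
| ExecSet x e s : expr_ok e s ->
    exec (CSet x e) s (expr_cost e + 2) (set_var s x (expr_val e s))
| ExecPut a e1 e2 s : expr_ok e1 s -> expr_ok e2 s -> index_ok (expr_val e1 s) ->
    exec (CPut a e1 e2) s (expr_cost e1 + expr_cost e2 + 6)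
      (set_arr s a (expr_val e1 s) (expr_val e2 s))
| ExecSeq c1 c2 s1 s2 s3 t1 t2 : exec c1 s1 t1 s2 -> exec c2 s2 t2 s3 ->
    exec (CSeq c1 c2) s1 (t1 + t2) s3
| ExecWhile0 e c s : expr_ok e s -> expr_val e s = 0 ->
    exec (CWhile e c) s (expr_cost e + 1) s
| ExecWhile1 e c s1 s2 s3 t1 t2 : expr_ok e s1 -> expr_val e s1 <> 0 ->
    exec c s1 t1 s2 -> exec (CWhile e c) s2 t2 s3 ->
    exec (CWhile e c) s1 (expr_cost e + 3 + t1 + t2) s3.

Definition binop_instr (o : binop) (d a b : nat) : instr :=
  match o with
  | OAdd => IAdd d a b | OSub => ISub d a b | OMul => IMul d a b
  | ODiv => IDiv d a b | OMod => IMod d a b | OXor => IXor d a b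
  | OLt => ILt d a b
  end.

Definition address_code (t a : nat) : seq instr :=
  [:: IConst t.+1 8; IMul t t t.+1; IAdd t t 3; IConst t.+1 (Z.of_nat a);
      IAdd t t t.+1].

Fixpoint expr_code (e : expr) (t : nat) : seq instr :=
  match e with
  | EVar x => [:: IConst t 0; IAdd t x t]
  | ECst z => [:: IConst t z]
  | EBin o e1 e2 => expr_code e1 t ++ expr_code e2 t.+1 ++ [:: binop_instr o t t t.+1]
  | EArr a e => expr_code e t ++ address_code t a ++ [:: ILoad t t]
  | ERaw e => expr_code e t ++ [:: ILoad t t]
  end.

(** Jump targets are absolute, so code depends on its own offset [o]. The machine has only
    conditional jumps; the jump back first loads 0 into the tested cell. *)
Fixpoint cmd_code (o : nat) (c : cmd) : seq instr :=
  match c with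
  | CSet x e => expr_code e ntemp ++ [:: IConst ntemp.+1 0; IAdd x ntemp ntemp.+1]
  | CPut a e1 e2 => expr_code e1 ntemp ++ address_code ntemp a
      ++ expr_code e2 ntemp.+1 ++ [:: IStore ntemp ntemp.+1]
  | CSeq c1 c2 => let l := cmd_code o c1 in l ++ cmd_code (o + size l) c2
  | CWhile e c =>
      let l := expr_code e ntemp in
      let b := cmd_code (o + size l + 1) c in
      l ++ [:: IJz ntemp (o + size l + size b + 3)] ++ b
        ++ [:: IConst ntemp 0; IJz ntemp o]
  end.

(** The temporaries form an evaluation stack starting at [t]; this check ensures that nesting never
    leaves the eight cells reserved for it. *)
Fixpoint expr_wf (t : nat) (e : expr) : bool :=
  match e with
  | EVar x => (x < ntemp)%N && (t < nreg)%N
  | ECst z => (t < nreg)%N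
  | EBin o e1 e2 => expr_wf t e1 && expr_wf t.+1 e2
  | EArr a e => [&& expr_wf t e, (a < 8)%N & (t.+1 < nreg)%N]
  | ERaw e => expr_wf t e
  end.

Fixpoint cmd_wf (c : cmd) : bool :=
  match c with
  | CSet x e => [&& (x < ntemp)%N, x != 3%N & expr_wf ntemp e]
  | CPut a e1 e2 => [&& expr_wf ntemp e1, expr_wf ntemp.+1 e2 & (a < 8)%N]
  | CSeq c1 c2 => cmd_wf c1 && cmd_wf c2
  | CWhile e c => expr_wf ntemp e && cmd_wf c
  end.

(** The temporaries are left unconstrained. Input cells from 32 up to [X] keep their initial
    contents, because compiled code stores only into variables, temporaries and array cells, and the
    latter start at [X]. *)
Definition represents (s : state) (M : nat -> Z) : Prop :=
  [/\ forall x, (x < ntemp)%N -> M x = var s x,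
      forall j, (nreg <= j)%N -> Z.of_nat j < X -> M j = raw (Z.of_nat j),
      forall a i, (a < 8)%N -> 0 <= i ->
        M (Z.to_nat (X + 8 * i + Z.of_nat a)) = arr s a i,
      forall j, in_range (M j)
    & var s 3%N = X].

(** The effect of one instruction on memory alone, obtained from the machine by running it as a
    one-line program; this separates straight-line code from program counters. *)
Definition instr_step (i : instr) (M : nat -> Z) : option (nat -> Z) :=
  omap Defs.mem (step W [:: i] (Config 0 M)).

Fixpoint code_step (l : seq instr) (M : nat -> Z) : option (nat -> Z) :=
  if l is i :: l' then obind (code_step l') (instr_step i M) else Some M.

Definition straight (i : instr) : bool :=
  match i with IJz _ _ | IHalt => false | _ => true end.

Lemma code_step_cat l1 l2 M :
  code_step (l1 ++ l2) M = obind (code_step l2) (code_step l1 M).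
Proof. by elim: l1 M => //= i l IH M; case: instr_step => //=. Qed.

Lemma run_add P t1 t2 c : run W P (t1 + t2) c = obind (run W P t2) (run W P t1 c).
Proof. by elim: t1 c => //= t IH c; rewrite ?addSn /=; case: step => //=. Qed.

Lemma step_straight P (o : nat) M i :
  (o < size P)%N -> nth IHalt P o = i -> straight i ->
  step W P (Config o M) = omap (Config o.+1) (instr_step i M).
Proof.
rewrite /instr_step /step /= => -> ->.
by case: i => //= *; do ?case: ifP.
Qed.

Lemma run_straight l P pre post M :
  all straight l -> P = pre ++ l ++ post ->
  run W P (size l) (Config (size pre) M)
  = omap (Config (size pre + size l)) (code_step l M).
Proof.
elim: l pre M => [|i l IH] pre M /=; first by rewrite addn0.
case/andP=> si sl EP; rewrite (@step_straight P (size pre) M i) //; last 2 first.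
- by rewrite EP !size_cat /= !addnS ltnS leq_addr.
- by rewrite EP nth_cat ltnn subnn.
case: instr_step => //= M'.
have := IH (rcons pre i) M' sl; rewrite size_rcons addSnnS; apply.
by rewrite EP -cats1 -catA.
Qed.

Lemma size_expr_code e t : size (expr_code e t) = expr_cost e.
Proof.
elim: e t => //= [o e1 IH1 e2 IH2|a e IH|e IH] t; rewrite !size_cat ?IH1 ?IH2 ?IH //=.
by rewrite addnA.
Qed.

Lemma straight_expr_code e t : all straight (expr_code e t).
Proof.
elim: e t => //= [o e1 IH1 e2 IH2|a e IH|e IH] t; rewrite !all_cat ?IH1 ?IH2 ?IH //=.
by case: o.
Qed.

Lemma in_wordP v : in_range v -> in_word W v.
Proof. by rewrite /in_range /in_word; lia. Qed.

Lemma updE M d v i : upd M d v i = if i == d then v else M i.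
Proof. by []. Qed.

Lemma upd_in_range M d v : (forall j, in_range (M j)) -> in_range v ->
  forall j, in_range (upd M d v j).
Proof. by move=> HM Hv j; rewrite updE; case: eqP. Qed.

Lemma code_step_const d z l M : in_range z ->
  code_step (IConst d z :: l) M = code_step l (upd M d z).
Proof. by move=> zW; rewrite /= /instr_step /step /= in_wordP. Qed.

Lemma code_step_bin o d a b l M : binop_ok o (M a) (M b) ->
  code_step (binop_instr o d a b :: l) M
  = code_step l (upd M d (binop_val o (M a) (M b))).
Proof.
by case: o => /=; rewrite /instr_step /step /=;
  try (by move=> vW; rewrite in_wordP);
  try (by move=> [/Z.eqb_neq -> vW]; rewrite in_wordP);
  move=> _; rewrite in_wordP //; rewrite /in_range; case: ifP; lia.
Qed.

Lemma binop_in_range o u v : binop_ok o u v -> in_range (binop_val o u v).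
Proof. by case: o => //= [[]|[]|_] //; rewrite /in_range; case: ifP; lia. Qed.

Local Arguments code_step : simpl never.

Lemma address_code_correct (t a : nat) M i :
  (nreg > t.+1)%N -> (t >= ntemp)%N -> (a < 8)%N -> M 3%N = X -> M t = i -> index_ok i ->
  (forall j, in_range (M j)) ->
  exists M', [/\ code_step (address_code t a) M = Some M',
    M' t = X + 8 * i + Z.of_nat a,
    forall y, (y < t)%N \/ (nreg <= y)%N -> M' y = M y
    & forall j, in_range (M' j)].
Proof.
move=> tR tT a8 M3 Mt [i0 iW] MW.
have n1 : (t.+1 == t) = false by lia.
have n2 : (t == t.+1) = false by lia.
have n3 : (3%N == t) = false by lia.
have n4 : (3%N == t.+1) = false by lia.
have W8 : in_range 8 by rewrite /in_range; lia.
have Wi : in_range (i * 8) by rewrite /in_range; lia.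
have Wx : in_range (i * 8 + X) by rewrite /in_range; lia.
have Wa : in_range (Z.of_nat a) by rewrite /in_range; lia.
have Wt : in_range (i * 8 + X + Z.of_nat a) by rewrite /in_range; lia.
rewrite /address_code code_step_const // (@code_step_bin OMul) /= ?updE ?eqxx ?n1 ?n2 ?Mt //.
rewrite (@code_step_bin OAdd) /= ?updE ?eqxx ?n1 ?n2 ?n3 ?n4 ?M3 // code_step_const //.
rewrite (@code_step_bin OAdd) /= ?updE ?eqxx ?n1 ?n2 ?n3 ?n4 ?M3 //.
eexists; split; first by reflexivity.
- by rewrite !updE eqxx; lia.
- by move=> y Hy; rewrite !updE; do !case: eqP => ? //; lia.
- by do !apply: upd_in_range.
Qed.

Lemma expr_wf_nreg t e : expr_wf t e -> (t < nreg)%N.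
Proof.
elim: e t => //= [x t /andP[] //|o e1 IH1 e2 _ t /andP[/IH1]|a e IH t /and3P[/IH]] //.
Qed.

Lemma represents_frame s M M' t : represents s M -> (ntemp <= t)%N ->
  (forall y, (y < t)%N \/ (nreg <= y)%N -> M' y = M y) ->
  (forall j, in_range (M' j)) -> represents s M'.
Proof.
move=> [Mx Mraw Marr MW M3] tT F W'; split=> //.
- by move=> x xT; rewrite F ?Mx //; lia.
- by move=> j jR jX; rewrite F ?Mraw //; lia.
- by move=> a i a8 i0; rewrite F ?Marr //; lia.
Qed.

(** Evaluation at stack level [t] preserves everything below [t]; hence the first operand, kept in
    cell [t], survives the evaluation of the second at level [t.+1]. *)
Lemma expr_code_correct e t s M : (ntemp <= t)%N -> expr_wf t e ->
  represents s M -> expr_ok e s ->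
  exists M', [/\ code_step (expr_code e t) M = Some M', M' t = expr_val e s,
    forall y, (y < t)%N \/ (nreg <= y)%N -> M' y = M y
    & forall j, in_range (M' j)].
Proof.
elim: e t M => [x|z|o e1 IH1 e2 IH2|a e IH|e IH] t M tT.
- case/andP=> xT tR [Mx Mraw Marr MW M3] _.
  have W0 : in_range 0 by rewrite /in_range; lia.
  have E : (x == t) = false by lia.
  have V : in_range (M x + 0) by rewrite Z.add_0_r.
  rewrite /expr_code code_step_const // (@code_step_bin OAdd) /= ?updE ?eqxx E //.
  eexists; split; first by reflexivity.
  + by rewrite updE eqxx Z.add_0_r Mx.
  + by move=> y Hy; rewrite !updE; do !case: eqP => ? //; move: tR; lia.
  + by do !apply: upd_in_range.
- move=> tR [Mx Mraw Marr MW M3] zW; rewrite /expr_code code_step_const //.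
  eexists; split; first by reflexivity.
  + by rewrite updE eqxx.
  + by move=> y Hy; rewrite !updE; do !case: eqP => ? //; move: tR => /=; lia.
  + by do !apply: upd_in_range.
- case/andP=> wf1 wf2 rM [ok1 [ok2 ok]].
  have [M1 [E1 V1 F1 W1]] := IH1 _ _ tT wf1 rM ok1.
  have tT' : (ntemp <= t.+1)%N by lia.
  have [M2 [E2 V2 F2 W2]] := IH2 _ M1 tT' wf2 (represents_frame rM tT F1 W1) ok2.
  have M2t : M2 t = expr_val e1 s by rewrite F2 ?V1 //; lia.
  have tR := expr_wf_nreg wf2.
  rewrite /= !code_step_cat E1 /= code_step_cat E2 [obind _ _]/=.
  rewrite -[[:: _]]/([:: _] ++ nil) code_step_bin ?M2t ?V2 //.
  eexists; split; first by reflexivity.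
  + by rewrite updE eqxx.
  + move=> y Hy; rewrite updE; case: eqP => [?|_]; first by lia.
    by rewrite F2 ?F1 //; lia.
  + by apply: upd_in_range => //; apply: binop_in_range.
- case/and3P=> wf a8 tR rM [ok iok].
  have [M1 [E1 V1 F1 W1]] := IH _ _ tT wf rM ok.
  have rM1 := represents_frame rM tT F1 W1.
  have M13 : M1 3%N = X by case: rM1 => H1 _ _ _ <-; apply: H1.
  have [M2 [E2 V2 F2 W2]] := address_code_correct tR tT a8 M13 V1 iok W1.
  rewrite -[expr_code _ _]/(expr_code e t ++ address_code t a ++ [:: ILoad t t]).
  rewrite code_step_cat E1 -[obind _ _]/(code_step _ M1) code_step_cat E2 /= /code_step /instr_step /step /= V2.
  have [_ _ /(_ a (expr_val e s) a8 (proj1 iok)) H _ _] := represents_frame rM1 tT F2 W2.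
  have -> : (0 <=? X + 8 * expr_val e s + Z.of_nat a) by case: iok => *; lia.
  rewrite in_wordP /=; last exact: W2.
  eexists; split; first by reflexivity.
  + by rewrite updE eqxx.
  + move=> y Hy; rewrite updE; case: eqP => [?|_]; first by lia.
    by rewrite F2 ?F1 //; lia.
  + by apply: upd_in_range.
- move=> wf rM [ok iok].
  have [M1 [E1 V1 F1 W1]] := IH _ _ tT wf rM ok.
  have tR := expr_wf_nreg wf.
  rewrite /= !code_step_cat E1 /= /code_step /instr_step /step /= V1.
  have -> : (0 <=? expr_val e s) by lia.
  rewrite in_wordP /=; last exact: W1.
  have [_ /(_ (Z.to_nat (expr_val e s))) H _ _ _] := represents_frame rM tT F1 W1.
  eexists; split; first by reflexivity.
  + by rewrite updE eqxx H ?Z2Nat.id //; lia.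
  + move=> y Hy; rewrite updE; case: eqP => [?|_]; first by lia.
    by rewrite F1 //; lia.
  + by apply: upd_in_range.
Qed.

Local Arguments Nat.eqb : simpl never.
Lemma run_code l P pre post M M' : all straight l -> P = pre ++ l ++ post ->
  code_step l M = Some M' ->
  run W P (size l) (Config (size pre) M) = Some (Config (size pre + size l) M').
Proof. by move=> sl EP E; rewrite (run_straight _ sl EP) E. Qed.

Lemma run_jump P pre r l post M : P = pre ++ IJz r l :: post ->
  run W P 1 (Config (size pre) M)
  = Some (Config (if M r =? 0 then l else (size pre).+1) M).
Proof.
move=> ->; rewrite /= /step /= size_cat /= addnS ltnS leq_addr.
by rewrite nth_cat ltnn subnn /=.
Qed.

Lemma represents_set_var s M x v : represents s M -> (x < ntemp)%N -> x != 3%N ->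
  in_range v -> represents (set_var s x v) (upd M x v).
Proof.
move=> [Mx Mraw Marr MW M3] xT x3 vW; split=> /=.
- move=> y yT; rewrite updE; case: eqP => [->|/eqP yx]; first by rewrite Nat.eqb_refl.
  by rewrite Mx //; case: Nat.eqb_spec => // E; rewrite E eqxx in yx.
- by move=> j jR jX; rewrite updE Mraw //; case: eqP => // ?; lia.
- by move=> a i a8 i0; rewrite updE Marr //; case: eqP => // ?; lia.
- exact: upd_in_range.
- by case: Nat.eqb_spec => // E; rewrite -E eqxx in x3.
Qed.

Lemma represents_set_arr s M a i v : represents s M -> (a < 8)%N -> 0 <= i ->
  in_range v ->
  represents (set_arr s a i v) (upd M (Z.to_nat (X + 8 * i + Z.of_nat a)) v).
Proof.
move=> [Mx Mraw Marr MW M3] a8 i0 vW; split=> //=.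
- by move=> y yT; rewrite updE Mx //; case: eqP => // ?; lia.
- by move=> j jR jX; rewrite updE Mraw //; case: eqP => // ?; lia.
- move=> b j b8 j0; rewrite updE Marr //.
  case: Nat.eqb_spec => [->|ba]; last by case: eqP => // ?; lia.
  by case: Z.eqb_spec => [->|ji]; [rewrite eqxx | case: eqP => // ?; lia].
- exact: upd_in_range.
Qed.

(** Induction on the execution rather than on the command, since a loop meets its own code again.
    The surrounding code [pre] and [post] is universally quantified so that the induction hypotheses
    apply inside larger programs. *)
Lemma cmd_code_correct c s t s' : exec c s t s' -> cmd_wf c ->
  forall P pre post M, P = pre ++ cmd_code (size pre) c ++ post -> represents s M ->
  exists M', run W P t (Config (size pre) M)
    = Some (Config (size pre + size (cmd_code (size pre) c)) M') /\ represents s' M'.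
Proof.
have W0 : in_range 0 by rewrite /in_range; lia.
elim=> {c s t s'}.
- move=> x e s ok /= /and3P[xT x3 wf] P pre post M EP rM.
  have [M1 [E1 V1 F1 W1]] := expr_code_correct (leqnn _) wf rM ok.
  set l := expr_code e 24 ++ _ in EP *.
  have sl : size l = (expr_cost e + 2)%N by rewrite size_cat size_expr_code.
  exists (upd (upd M1 25 0) x (expr_val e s)); split; last first.
    apply: represents_set_var => //; last by rewrite -V1; exact: W1.
    apply: (represents_frame rM (leqnn _)); last exact: upd_in_range.
    by move=> y Hy; rewrite updE F1 //; case: eqP => // ?; lia.
  rewrite -sl; apply: (run_code _ EP).
    by rewrite all_cat straight_expr_code.
  rewrite code_step_cat E1 -[obind _ _]/(code_step _ M1) code_step_const //.
  have Ev : upd M1 25 0 24 + upd M1 25 0 25 = expr_val e s by rewrite !updE /= V1 Z.add_0_r.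
  by rewrite (@code_step_bin OAdd) /= Ev // -V1; exact: W1.
- move=> a e1 e2 s ok1 ok2 iok /and3P[wf1 wf2 a8] P pre post M EP rM.
  have [M1 [E1 V1 F1 W1]] := expr_code_correct (leqnn _) wf1 rM ok1.
  have rM1 := represents_frame rM (leqnn _) F1 W1.
  have M13 : M1 3%N = X by case: rM1 => H1 _ _ _ <-; apply: H1.
  have [M2 [E2 V2 F2 W2]] := address_code_correct (isT : 25 < 32)%N (leqnn _) a8 M13 V1 iok W1.
  have rM2 := represents_frame rM1 (leqnn _) F2 W2.
  have [M3 [E3 V3 F3 W3]] := expr_code_correct (isT : 24 <= 25)%N wf2 rM2 ok2.
  have rM3 := represents_frame rM2 (isT : 24 <= 25)%N F3 W3.
  have V24 : M3 24%N = X + 8 * expr_val e1 s + Z.of_nat a by rewrite F3 //; left.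
  pose l := expr_code e1 24 ++ address_code 24 a ++ expr_code e2 25 ++ [:: IStore 24 25].
  rewrite -[cmd_code _ _]/l in EP *.
  have sl : size l = (expr_cost e1 + expr_cost e2 + 6)%N.
    by rewrite size_cat /= size_cat !size_expr_code /=; lia.
  exists (upd M3 (Z.to_nat (X + 8 * expr_val e1 s + Z.of_nat a)) (expr_val e2 s)).
  split; last first.
    by apply: represents_set_arr => //; [case: iok | rewrite -V3; exact: W3].
  rewrite -sl; apply: (run_code _ EP).
    by rewrite all_cat straight_expr_code /= all_cat straight_expr_code.
  rewrite code_step_cat E1 -[obind _ _]/(code_step _ M1).
  rewrite code_step_cat E2 -[obind _ _]/(code_step _ M2).
  rewrite code_step_cat E3 -[obind _ _]/(code_step _ M3).
  rewrite /code_step /instr_step /step /= V24 V3.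
  have -> : (0 <=? X + 8 * expr_val e1 s + Z.of_nat a) by case: iok => *; lia.
  by rewrite in_wordP // -V3; exact: W3.
- move=> c1 c2 s1 s2 s3 t1 t2 _ IH1 _ IH2 /= /andP[wf1 wf2] P pre post M EP rM.
  rewrite -catA in EP.
  have [M1 [R1 rM1]] := IH1 wf1 _ _ _ _ EP rM.
  have EP2 : P = (pre ++ cmd_code (size pre) c1) ++
      cmd_code (size (pre ++ cmd_code (size pre) c1)) c2 ++ post.
    by rewrite EP size_cat -catA.
  have [M2 [R2 rM2]] := IH2 wf2 _ _ _ _ EP2 rM1.
  exists M2; split => //; rewrite run_add R1 /=.
  by rewrite size_cat in R2; rewrite R2 size_cat addnA.
- move=> e c s ok v0 /= /andP[wf1 wf2] P pre post M EP rM.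
  have [M1 [E1 V1 F1 W1]] := expr_code_correct (leqnn _) wf1 rM ok.
  have rM1 := represents_frame rM (leqnn _) F1 W1.
  exists M1; split => //; rewrite -catA in EP.
  have := run_code (straight_expr_code _ _) EP E1.
  rewrite run_add size_expr_code => -> /=.
  have EP2 := EP; rewrite catA in EP2.
  have := run_jump M1 EP2; rewrite size_cat size_expr_code /= => ->.
  by rewrite V1 v0 /= !size_cat /= size_cat size_expr_code /=; congr (Some (Config _ _)); lia.
- move=> e c s1 s2 s3 t1 t2 ok v0 _ IH1 _ IH2 /= /andP[wf1 wf2] P pre post M EP rM.
  have [M1 [E1 V1 F1 W1]] := expr_code_correct (leqnn _) wf1 rM ok.
  have rM1 := represents_frame rM (leqnn _) F1 W1.
  have EP0 := EP; rewrite -!catA /= -!catA /= in EP.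
  have R1 := run_code (straight_expr_code _ _) EP E1.
  have EP2 := EP; rewrite catA in EP2.
  have R2 := run_jump M1 EP2; rewrite V1 in R2.
  move/Z.eqb_neq: (v0) R2 => -> R2.
  set b := cmd_code _ c in EP EP2.
  have EP3 : P = (rcons (pre ++ expr_code e 24) (IJz 24
      (size pre + size (expr_code e 24) + size b + 3)))
      ++ b ++ ([:: IConst 24 0; IJz 24 (size pre)] ++ post).
    by rewrite EP2 -cats1 -!catA /=.
  have Eb : b = cmd_code (size (rcons (pre ++ expr_code e 24) (IJz 24
      (size pre + size (expr_code e 24) + size b + 3)))) c.
    by rewrite size_rcons size_cat /b addn1.
  rewrite {2}Eb in EP3.
  have [M2 [R3 rM2]] := IH1 wf2 _ _ _ _ EP3 rM1.
  rewrite -Eb in R3 EP3.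
  (* The 0 loaded for the jump back goes into a temporary, which [represents] does not mention. *)
  have M3r : represents s2 (upd M2 24 0).
    case: (rM2) => _ _ _ MW _.
    apply: (represents_frame rM2 (leqnn _)); last exact: upd_in_range.
    by move=> y Hy; rewrite updE; case: eqP => // ?; lia.
  have EP4 := EP3; rewrite catA in EP4.
  have EP5 : P = ((rcons (pre ++ expr_code e 24) (IJz 24
      (size pre + size (expr_code e 24) + size b + 3)) ++ b) ++ [:: IConst 24 0])
      ++ IJz 24 (size pre) :: post by rewrite EP4 -!catA.
  have R4 := @run_code [:: IConst 24 0] _ _ _ M2 (upd M2 24 0) isT EP4 (@code_step_const 24 0 [::] M2 W0).
  have R5 := run_jump (upd M2 24 0) EP5; rewrite updE eqxx Z.eqb_refl in R5.
  have [M4 [R6 rM4]] := IH2 (introT andP (conj wf1 wf2)) _ _ _ _ EP0 M3r.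
  exists M4; split=> //.
  have -> : (expr_cost e + 3 + t1 + t2 =
     size (expr_code e 24) + (1 + (t1 + (1 + (1 + t2)))))%N by rewrite size_expr_code; lia.
  rewrite !(size_rcons, size_cat) in R2 R3 R4 R5.
  by rewrite run_add R1 [obind _ _]run_add R2 [obind _ _]run_add R3
    [obind _ _]run_add R4 [obind _ _]run_add R5.
Qed.

End Compiler.

(** * Frames and a program logic with time bounds *)

Fixpoint written_vars (c : cmd) : seq nat :=
  match c with
  | CSet x _ => [:: x]
  | CPut _ _ _ => [::]
  | CSeq c1 c2 => written_vars c1 ++ written_vars c2
  | CWhile _ c => written_vars c
  end.

Fixpoint written_arrs (c : cmd) : seq nat :=
  match c with
  | CSet _ _ => [::]
  | CPut a _ _ => [:: a]
  | CSeq c1 c2 => written_arrs c1 ++ written_arrs c2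
  | CWhile _ c => written_arrs c
  end.

Record frame (xs ars : seq nat) (s s' : state) : Prop := Frame {
  frame_var : forall x, x \notin xs -> var s' x = var s x;
  frame_arr : forall a, a \notin ars -> arr s' a = arr s a }.

Definition frame_of (c : cmd) := frame (written_vars c) (written_arrs c).

Lemma frame_refl xs ars s : frame xs ars s s.
Proof. by []. Qed.

Lemma frame_trans xs ars s1 s2 s3 :
  frame xs ars s1 s2 -> frame xs ars s2 s3 -> frame xs ars s1 s3.
Proof.
move=> [V1 A1] [V2 A2]; split=> x xP; first by rewrite V2 ?V1.
by rewrite A2 ?A1.
Qed.

Lemma frame_sub xs ars xs' ars' s s' : {subset xs <= xs'} -> {subset ars <= ars'} ->
  frame xs ars s s' -> frame xs' ars' s s'.
Proof.
move=> sx sa [V A]; split=> x xP; [apply: V | apply: A]; apply: contra xP.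
  exact: sx.
exact: sa.
Qed.

Definition CFor (x y : nat) (c : cmd) : cmd :=
  CWhile (EBin OLt (EVar x) (EVar y))
    (CSeq c (CSet x (EBin OAdd (EVar x) (ECst 1)))).

Section Hoare.
Local Open Scope Z_scope.
Variables (W X : Z) (raw : Z -> Z).

Lemma exec_frame c s t s' : exec W X raw c s t s' -> frame_of c s s'.
Proof.
rewrite /frame_of; elim=> {c s t s'} //=.
- move=> x e s _; split=> //= y; rewrite inE => /eqP yx.
  by case: Nat.eqb_spec.
- move=> a e1 e2 s _ _ _; split=> //= b; rewrite inE => /eqP ba.
  by case: Nat.eqb_spec.
- move=> c1 c2 s1 s2 s3 t1 t2 _ F1 _ F2.
  apply: (frame_trans (s2 := s2)).
    by apply: frame_sub F1 => x; rewrite mem_cat => ->.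
  by apply: frame_sub F2 => x; rewrite mem_cat orbC => ->.
- move=> e c s1 s2 s3 t1 t2 _ _ _ F1 _ F2; exact: frame_trans F1 F2.
Qed.

(** Total correctness from one concrete state instead of a precondition: postconditions can refer to
    the initial contents, and a proof amounts to symbolic execution. *)
Definition hoare (s : state) (c : cmd) (T : Z) (R : state -> Prop) : Prop :=
  exists t s', [/\ exec W X raw c s t s', Z.of_nat t <= T & R s'].

Lemma hoare_weaken s c T T' (R R' : state -> Prop) :
  hoare s c T R -> T <= T' -> (forall s', frame_of c s s' -> R s' -> R' s') ->
  hoare s c T' R'.
Proof.
move=> [t [s' [E tT r]]] TT RR; exists t, s'; split=> //; first by lia.
exact: RR (exec_frame E) r.
Qed.

Lemma hoare_set s x e T (R : state -> Prop) :
  expr_ok W X raw e s -> R (set_var s x (expr_val raw e s)) ->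
  Z.of_nat (expr_cost e + 2) <= T -> hoare s (CSet x e) T R.
Proof. by move=> ok r cT; do 2!eexists; split; [exact: ExecSet | | exact: r]. Qed.

Lemma hoare_put s a e1 e2 T (R : state -> Prop) :
  expr_ok W X raw e1 s -> expr_ok W X raw e2 s -> index_ok W X (expr_val raw e1 s) ->
  R (set_arr s a (expr_val raw e1 s) (expr_val raw e2 s)) ->
  Z.of_nat (expr_cost e1 + expr_cost e2 + 6) <= T -> hoare s (CPut a e1 e2) T R.
Proof. by move=> ok1 ok2 iok r cT; do 2!eexists; split; [exact: ExecPut | | exact: r]. Qed.

(** The continuation receives the frame of the first command, so intermediate assertions need only
    speak of what has changed. *)
Lemma hoare_seq s c1 c2 T1 T (Q R : state -> Prop) :
  hoare s c1 T1 Q ->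
  (forall s', frame_of c1 s s' -> Q s' -> hoare s' c2 (T - T1) R) ->
  hoare s (CSeq c1 c2) T R.
Proof.
move=> [t1 [s1 [E1 T1P q]]] /(_ _ (exec_frame E1) q)[t2 [s2 [E2 T2P r]]].
by exists (t1 + t2)%N, s2; split=> //; [exact: ExecSeq E2 | lia].
Qed.

Lemma hoare_set_seq s x e c T (R : state -> Prop) :
  expr_ok W X raw e s ->
  hoare (set_var s x (expr_val raw e s)) c (T - Z.of_nat (expr_cost e + 2)) R ->
  hoare s (CSeq (CSet x e) c) T R.
Proof.
move=> ok [t2 [s2 [E2 T2P r]]]; exists (expr_cost e + 2 + t2)%N, s2.
by split=> //; [apply: ExecSeq E2; exact: ExecSet | lia].
Qed.

Lemma hoare_put_seq s a e1 e2 c T (R : state -> Prop) :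
  expr_ok W X raw e1 s -> expr_ok W X raw e2 s -> index_ok W X (expr_val raw e1 s) ->
  hoare (set_arr s a (expr_val raw e1 s) (expr_val raw e2 s)) c
    (T - Z.of_nat (expr_cost e1 + expr_cost e2 + 6)) R ->
  hoare s (CSeq (CPut a e1 e2) c) T R.
Proof.
move=> ok1 ok2 iok [t2 [s2 [E2 T2P r]]].
exists (expr_cost e1 + expr_cost e2 + 6 + t2)%N, s2.
by split=> //; [apply: ExecSeq E2; exact: ExecPut | lia].
Qed.

(* TT is the cumulative time of the iterations. *)
Lemma hoare_while s e c (a b : nat) (TT : nat -> Z) (I : nat -> state -> Prop) :
  (a <= b)%N -> I a s ->
  (forall i s', (a <= i < b)%N -> frame_of c s s' -> I i s' ->
     [/\ expr_ok W X raw e s', expr_val raw e s' <> 0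
       & hoare s' c (TT i.+1 - TT i - Z.of_nat (expr_cost e + 3)) (I i.+1)]) ->
  (forall s', frame_of c s s' -> I b s' ->
     expr_ok W X raw e s' /\ expr_val raw e s' = 0) ->
  hoare s (CWhile e c) (TT b - TT a + Z.of_nat (expr_cost e + 1)) (I b).
Proof.
move=> ab Ia step stop; have [d Ed] : {d | b = (a + d)%N} by exists (b - a)%N; lia.
elim: d a s ab Ia step stop Ed => [|d IH] a s ab Ia step stop Ed.
  have {}Ed : b = a by lia.
  subst b; have [ok v0] := stop _ (frame_refl _ _ _) Ia.
  exists (expr_cost e + 1)%N, s; split=> //; [exact: ExecWhile0 | lia].
have [|ok v0 [t1 [s1 [E1 T1 I1]]]] := step a s _ (frame_refl _ _ _) Ia; first by lia.
have F1 := exec_frame E1.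
have [||||t2 [s2 [E2 T2 I2]]] := IH a.+1 s1 _ I1; try lia.
- move=> i s' ib F; apply: step; first by lia.
  exact: frame_trans F1 F.
- by move=> s' F; apply: stop; exact: frame_trans F1 F.
exists (expr_cost e + 3 + t1 + t2)%N, s2; split=> //; last by lia.
exact: ExecWhile1 E1 E2.
Qed.

(** An iteration spends 8 steps on the test and the jumps and 6 on the increment, together 14; the
    last test and exit cost 6. *)
Lemma hoare_for s x y c (a b : nat) (TT : nat -> Z) (I : nat -> state -> Prop) :
  8 <= W -> (a <= b)%N -> Z.of_nat b <= W ->
  x != y -> x \notin written_vars c -> y \notin written_vars c ->
  var s x = Z.of_nat a -> var s y = Z.of_nat b -> I a s ->
  (forall i s', (a <= i < b)%N ->
     frame (x :: written_vars c) (written_arrs c) s s' ->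
     var s' x = Z.of_nat i -> I i s' ->
     hoare s' c (TT i.+1 - TT i - 14)
       (fun s'' => I i.+1 (set_var s'' x (Z.of_nat i.+1)))) ->
  hoare s (CFor x y c) (TT b - TT a + 6) (I b).
Proof.
move=> W8 ab bW xy xc yc sx sy Ia step.
have F0 s' : frame_of (CSeq c (CSet x (EBin OAdd (EVar x) (ECst 1)))) s s' ->
    frame (x :: written_vars c) (written_arrs c) s s'.
  by apply: frame_sub => z; rewrite mem_cat ?orbF // mem_seq1 in_cons orbC.
have Y s' : frame (x :: written_vars c) (written_arrs c) s s' -> var s' y = Z.of_nat b.
  by move=> F; rewrite (frame_var F) // inE negb_or eq_sym xy.
apply: hoare_weaken (@hoare_while s _ _ a b TT
    (fun i s' => var s' x = Z.of_nat i /\ I i s') ab (conj sx Ia) _ _) _ _ => //=.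
- move=> i s' iab /F0 F [xi Ii]; rewrite (Y _ F) xi; split=> //.
    by case: Z.ltb_spec; lia.
  have [t [s1 [E T1 R1]]] := step _ _ iab F xi Ii.
  have x1 : var s1 x = Z.of_nat i by rewrite (frame_var (exec_frame E)).
  apply: (hoare_seq (T1 := Z.of_nat t) (Q := fun s' => s' = s1)).
    by exists t, s1; split=> //; lia.
  move=> _ _ ->; apply: hoare_set.
  + by rewrite /= /in_range x1; lia.
  + rewrite /= x1 Nat.eqb_refl; split; first by lia.
    by have -> : Z.of_nat i + 1 = Z.of_nat i.+1 by lia.
  + by rewrite /=; lia.
- move=> s' /F0 F [xi Ii]; rewrite (Y _ F) xi; split=> //.
  by case: Z.ltb_spec; lia.
- by rewrite /=; lia.
- by move=> s' _ [].
Qed.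

(* reg i is the set of cells written before iteration i, and f the final
   contents of the cells. *)
Lemma hoare_fill s x y ar e1 e2 (a b : nat) (pos f : Z -> Z) (reg : nat -> Z -> bool) :
  8 <= W -> (a <= b)%N -> Z.of_nat b <= W -> x != y ->
  var s x = Z.of_nat a -> var s y = Z.of_nat b ->
  (expr_cost e1 + expr_cost e2 <= 180)%N ->
  (forall q, reg a q = false) ->
  (forall i q, (a <= i < b)%N -> reg i.+1 q = reg i q || (q =? pos (Z.of_nat i))) ->
  (forall i s', (a <= i < b)%N -> frame [:: x] [:: ar] s s' -> var s' x = Z.of_nat i ->
     (forall q, arr s' ar q = if reg i q then f q else arr s ar q) ->
     [/\ expr_ok W X raw e1 s', expr_ok W X raw e2 s',
         expr_val raw e1 s' = pos (Z.of_nat i), index_ok W X (pos (Z.of_nat i))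
       & expr_val raw e2 s' = f (pos (Z.of_nat i))]) ->
  hoare s (CFor x y (CPut ar e1 e2)) (200 * Z.of_nat (b - a) + 6)
    (fun s' => forall q, arr s' ar q = if reg b q then f q else arr s ar q).
Proof.
move=> W8 ab bW xy sx sy cost reg0 regS step.
apply: hoare_weaken (@hoare_for s x y (CPut ar e1 e2) a b (fun i => 200 * Z.of_nat i)
  (fun i s' => forall q, arr s' ar q = if reg i q then f q else arr s ar q)
  W8 ab bW xy _ _ sx sy _ _) _ _ => //.
- by move=> q; rewrite reg0.
- move=> i s' iab F xi Ii.
  have [ok1 ok2 V1 iok V2] := step _ _ iab F xi Ii.
  apply: hoare_put => //; rewrite ?V1 //; last by lia.
  move=> q; rewrite /= Nat.eqb_refl regS // V2.
  by case: Z.eqb_spec => [->|_]; rewrite ?orbT ?orbF.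
- by lia.
Qed.

End Hoare.

(** * The path detection program *)

Notation "e1 '+e' e2" := (EBin OAdd e1 e2) (at level 50, left associativity).
Notation "e1 '-e' e2" := (EBin OSub e1 e2) (at level 50, left associativity).
Notation "e1 '*e' e2" := (EBin OMul e1 e2) (at level 40, left associativity).
Notation "e1 '/e' e2" := (EBin ODiv e1 e2) (at level 40, left associativity).
Notation "e1 '%e' e2" := (EBin OMod e1 e2) (at level 40, left associativity).
Notation "e1 '^e' e2" := (EBin OXor e1 e2) (at level 50, left associativity).
Notation "e1 '<e' e2" := (EBin OLt e1 e2) (at level 70).
Notation "c1 ;; c2" := (CSeq c1 c2) (at level 90, right associativity).

Notation vn := 0 (only parsing).
Notation vk := 2 (only parsing).
Notation vX := 3 (only parsing).
Notation vQ := 4 (only parsing).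
Notation vL := 5 (only parsing).
Notation vnL := 6 (only parsing).
Notation vt := 7 (only parsing).
Notation vv := 8 (only parsing).
Notation vi := 9 (only parsing).
Notation vj := 10 (only parsing).
Notation vp := 11 (only parsing).
Notation vend := 12 (only parsing).
Notation vlo := 13 (only parsing).
Notation vhi := 14 (only parsing).
Notation vrow := 15 (only parsing).
Notation vrow' := 16 (only parsing).
Notation vc := 17 (only parsing).
Notation vb := 18 (only parsing).
Notation vans := 19 (only parsing).
Notation vQQ := 20 (only parsing).

(* ainp: copy of the input cells; atab: products of limbs; abit: the counter
   encoding S; af, ag: one polynomial per vertex, before and after weighting by
   sum_(j in S) a_v^j; acur: the multiple a_v^j of a row of af, after two zero
   pads; ares: the accumulated result. *)
Notation ainp := 0 (only parsing).
Notation atab := 1 (only parsing).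
Notation abit := 2 (only parsing).
Notation af := 3 (only parsing).
Notation ag := 4 (only parsing).
Notation acur := 5 (only parsing).
Notation ares := 6 (only parsing).

(** [vlo] and [vhi] hold the two limbs of the vertex number already multiplied by [vQ], that is,
    offsets of table rows; adding a limb of [acur] addresses the product. Remainder and quotient by
    [vQ] are its low and high halves. *)
Definition mul_limb (pos : expr) : expr :=
  ((EArr atab (EVar vlo +e EArr acur pos) %e EVar vQ)
     ^e (EArr atab (EVar vlo +e EArr acur (pos -e ECst 1)) /e EVar vQ))
  ^e ((EArr atab (EVar vhi +e EArr acur (pos -e ECst 1)) %e EVar vQ)
     ^e (EArr atab (EVar vhi +e EArr acur (pos -e ECst 2)) /e EVar vQ)).

Definition clear_row (a : nat) : cmd :=
  CSet vi (ECst 0);; CFor vi vL (CPut a (EVar vrow +e EVar vi) (ECst 0)).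

(* Each new limb depends on the old ones at the same and the two previous
   positions, so the limbs are updated in place from the top down. *)
Definition multiply_cur : cmd :=
  CSet vi (ECst 0);;
  CFor vi vL (CPut acur ((EVar vL +e ECst 1) -e EVar vi)
                        (mul_limb ((EVar vL +e ECst 1) -e EVar vi))).

Definition weigh_step : cmd :=
  CSet vi (ECst 0);;
  CFor vi vL (CPut ag (EVar vrow +e EVar vi)
    (EArr ag (EVar vrow +e EVar vi)
       ^e (EArr abit (EVar vj) *e EArr acur (EVar vi +e ECst 2))));;
  multiply_cur.

Definition weigh : cmd :=
  CSet vrow (EVar vv *e EVar vL);;
  CSet vi (ECst 0);;
  CFor vi vL (CPut acur (EVar vi +e ECst 2) (EArr af (EVar vrow +e EVar vi)));;
  clear_row ag;;
  CSet vlo ((EVar vv %e EVar vQ) *e EVar vQ);;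
  CSet vhi ((EVar vv /e EVar vQ) *e EVar vQ);;
  CSet vj (ECst 0);;
  CFor vj vk weigh_step.

Definition gather_step : cmd :=
  CSet vrow' (EArr ainp (EVar vp +e (EVar vn +e ECst 4)) *e EVar vL);;
  CSet vi (ECst 0);;
  CFor vi vL (CPut af (EVar vrow +e EVar vi)
    (EArr af (EVar vrow +e EVar vi) ^e EArr ag (EVar vrow' +e EVar vi))).

Definition gather : cmd :=
  CSet vrow (EVar vv *e EVar vL);;
  clear_row af;;
  CSet vp (EArr ainp (EVar vv +e ECst 3));;
  CSet vend (EArr ainp (EVar vv +e ECst 4));;
  CFor vp vend gather_step.

Definition walk_step : cmd :=
  CSet vv (ECst 0);; CFor vv vn weigh;; CSet vv (ECst 0);; CFor vv vn gather.

Definition collect : cmd :=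
  CSet vrow (EVar vv *e EVar vL);;
  CSet vi (ECst 0);;
  CFor vi vL (CPut ares (EVar vi) (EArr ares (EVar vi) ^e EArr ag (EVar vrow +e EVar vi))).

Definition increment_step : cmd :=
  CSet vb (EArr abit (EVar vj));;
  CPut abit (EVar vj) (EVar vb ^e EVar vc);;
  CSet vc (EVar vb *e EVar vc).

(** Ripple-carry addition of 1. A carry out of the top bit means that the counter has wrapped around
    and all subsets have been seen; its negation is left in [vc], which is the loop condition of
    [search]. *)
Definition increment : cmd :=
  CSet vc (ECst 1);; CSet vj (ECst 0);; CFor vj vk increment_step;;
  CSet vc (ECst 1 -e EVar vc).

(** The first loop writes the polynomial 1 into every row: limb 0 is 1, all others are 0. At the end
    of the walk steps, [ag] holds for each vertex its weight times the sum over the remaining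
    [k - 1] vertices. *)
Definition round : cmd :=
  CSet vi (ECst 0);;
  CFor vi vnL (CPut af (EVar vi) (EVar vi %e EVar vL <e ECst 1));;
  CSet vt (ECst 0);; CFor vt vk walk_step;;
  CSet vv (ECst 0);; CFor vv vn collect;;
  increment.

(** [vQ] is doubled while its square is at most [n]; [n] iterations suffice and cost only linear
    time. [vans] starts as true exactly for [k = 0], where the empty path exists. The table is
    filled by the recurrence [clmul_half]. *)
Definition setup : cmd :=
  CSet vi (ECst 32);; CFor vi vX (CPut ainp (EVar vi) (ERaw (EVar vi)));;
  CSet vans (EVar vk <e ECst 1);;
  CSet vL (ECst 2 *e (EVar vk *e EVar vk) +e ECst 1);;
  CSet vnL (EVar vn *e EVar vL);;
  CSet vQ (ECst 1);; CSet vi (ECst 0);;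
  CFor vi vn (CSet vQ (EVar vQ +e EVar vQ *e (EVar vQ *e EVar vQ <e EVar vn +e ECst 1)));;
  CSet vQQ (EVar vQ *e EVar vQ);;
  CSet vi (ECst 0);;
  CFor vi vQQ (CPut atab (EVar vi)
    (ECst 2 *e EArr atab ((EVar vi -e EVar vi %e EVar vQ) +e (EVar vi %e EVar vQ) /e ECst 2)
     ^e ((EVar vi %e EVar vQ) %e ECst 2) *e (EVar vi /e EVar vQ))).

Definition search : cmd :=
  CSet vc (ECst 1);; CWhile (EVar vc) round;;
  CSet vi (ECst 0);; CFor vi vL (CSet vans (ECst 0 <e EVar vans +e EArr ares (EVar vi)));;
  CSet vn (EVar vans).

Definition program_body : cmd := setup;; search.

Lemma program_body_wf : cmd_wf program_body.
Proof. by vm_compute. Qed.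

(** * Correctness and running time of the program body *)

Definition input (n k : nat) (adj : seq (seq nat)) (i : Z) : Z :=
  input_mem n k adj (Z.to_nat i).

Section Program.
Local Open Scope Z_scope.
Local Arguments Z.add : simpl never.
Local Arguments Z.sub : simpl never.
Local Arguments Z.mul : simpl never.
Local Arguments Z.div : simpl never.
Local Arguments Z.modulo : simpl never.
Local Arguments Z.lxor : simpl never.
Local Arguments Z.of_nat : simpl never.
Local Arguments Z.pow : simpl never.

Variables (n m k s L : nat) (adj : seq (seq nat)) (W X : Z).
Local Notation raw := (input n k adj).
Variables (Q zn zk zL : Z).
Hypotheses (Q_def : Q = 2 ^ Z.of_nat s) (zn_def : zn = Z.of_nat n)
  (zk_def : zk = Z.of_nat k) (zL_def : zL = Z.of_nat L).
Hypothesis L_gt0 : (0 < L)%N.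
Hypothesis nQ : zn < Q * Q.
Hypothesis X_def : X = zn + Z.of_nat m + 32.
(** A common bound on array indices, limbs and table entries, so that most range conditions reduce
    to [0 <= z <= B]. *)
Variable B : Z.
Hypothesis B_def : B = zn * zL + zL + Q * Q + X + zk + 10.
Hypothesis XW : X + 8 * B + 8 <= W.
Hypothesis adjP : adj_wf n adj.
Hypothesis m_def : m = num_edges adj.

Record static (st : state) : Prop := Static {
  static_n : var st vn = zn;
  static_k : var st vk = zk;
  static_X : var st vX = X;
  static_Q : var st vQ = Q;
  static_L : var st vL = zL;
  static_nL : var st vnL = zn * zL;
  static_start : forall v : nat, (v <= n)%N ->
    arr st ainp (3 + Z.of_nat v) = Z.of_nat (sumn (map size (take v adj)));
  static_target : forall p : nat, (p < m)%N ->
    arr st ainp (4 + zn + Z.of_nat p) = Z.of_nat (nth 0%N (flatten adj) p);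
  static_table : forall a b, 0 <= a < Q -> 0 <= b < Q ->
    arr st atab (a * Q + b) = clmul a b }.

Lemma static_frame xs ars st st' : frame xs ars st st' ->
  all (fun x => x \notin xs) [:: vn; vk; vX; vQ; vL; vnL] ->
  all (fun a => a \notin ars) [:: ainp; atab] -> static st -> static st'.
Proof.
move=> [V A] /= /and5P[V0 V2 V3 V4 /and3P[V5 V6 _]] /and3P[A0 A1 _] [*].
by split; rewrite ?V ?A.
Qed.

Lemma static_set_var st x v : static st -> x \notin [:: vn; vk; vX; vQ; vL; vnL] ->
  static (set_var st x v).
Proof.
move=> S xP; apply: (static_frame (xs := [:: x]) (ars := [::]) _ _ _ S) => //.
  by split=> //= y; rewrite mem_seq1; case: Nat.eqb_spec => // ->; rewrite eqxx.
by apply/allP => y yP; rewrite mem_seq1; apply: contraNneq xP => <-.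
Qed.

Definition limb (z : Z) : Prop := 0 <= z < Q.

Lemma Q_gt0 : 0 < Q.
Proof. by rewrite Q_def; lia. Qed.

Lemma lxor_limb a b : limb a -> limb b -> limb (Z.lxor a b).
Proof. by rewrite /limb Q_def => *; apply: lxor_bound => //; lia. Qed.

Lemma limb_bound z : limb z -> 0 <= z < Q * Q.
Proof. by rewrite /limb; have := Q_gt0; nia. Qed.

Lemma mod_limb z : limb (z mod Q).
Proof. exact: Z.mod_pos_bound Q_gt0. Qed.

Lemma div_limb z : 0 <= z < Q * Q -> limb (z / Q).
Proof.
move=> H; have := Q_gt0; split; first by apply: Z.div_pos; lia.
by apply: Z.div_lt_upper_bound; lia.
Qed.

Definition new_limb (v : Z) (A : Z -> Z) (q : Z) : Z :=
  Z.lxor (Z.lxor (clmul (v mod Q) (A q) mod Q) (clmul (v mod Q) (A (q - 1)) / Q))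
         (Z.lxor (clmul (v / Q) (A (q - 1)) mod Q) (clmul (v / Q) (A (q - 2)) / Q)).

Lemma clmul_limbs a b : limb a -> limb b -> 0 <= clmul a b < Q * Q.
Proof. by rewrite /limb Q_def; exact: clmul_bound. Qed.

Lemma new_limb_limb v A q : 0 <= v < Q * Q -> (forall q, limb (A q)) ->
  limb (new_limb v A q).
Proof.
move=> vQ AQ; do !apply: lxor_limb; do ?apply: mod_limb;
  by apply/div_limb/clmul_limbs => //; first [exact: mod_limb | exact: div_limb].
Qed.

Lemma bpoly_limbs z : 0 <= z ->
  (bpoly (z mod Q) + 'X^s * bpoly (z / Q))%R = bpoly z.
Proof.
move=> z0; rewrite {3}(Z.div_mod z Q); last by have := Q_gt0; lia.
rewrite Z.add_comm [in RHS]Q_def bpoly_split -?Q_def //; first exact: mod_limb.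
by apply: Z.div_pos => //; exact: Q_gt0.
Qed.

(** An instance of [limbs_mul2] in which [c] reads the whole array including its two zero pads,
    which supply the vanishing half products at the bottom. *)
Lemma new_limb_mul v A A' : 0 <= v < Q * Q -> (forall q, limb (A q)) ->
  A 0 = 0 -> A 1 = 0 ->
  (forall i : nat, (i < L)%N -> A' (2 + Z.of_nat i) = new_limb v A (2 + Z.of_nat i)) ->
  eqXn (s * L) (limbs s A' 2 L) (bpoly v * limbs s A 2 L)%R.
Proof.
move=> vQ AQ A0 A1 AE.
pose c i := bpoly (A (Z.of_nat i)).
pose P u i := clmul u (A (Z.of_nat i)).
have PE u i : limb u -> (bpoly (P u i mod Q) + 'X^s * bpoly (P u i / Q))%R
    = (bpoly u * c i)%R.
  move=> uQ; have H := clmul_limbs uQ (AQ (Z.of_nat i)).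
  rewrite bpoly_limbs; last by rewrite /P; lia.
  by rewrite bpoly_clmul //; [case: uQ | case: (AQ (Z.of_nat i))].
have := @limbs_mul2 s c (fun i => bpoly (P (v mod Q) i mod Q))
   (fun i => bpoly (P (v mod Q) i / Q)) (fun i => bpoly (P (v / Q) i mod Q))
   (fun i => bpoly (P (v / Q) i / Q))
   (fun i => bpoly (new_limb v A (2 + Z.of_nat i))) (bpoly (v mod Q)) (bpoly (v / Q)) L.
rewrite bpoly_limbs; last by lia.
have -> : (\sum_(i < L) 'X^(s * i) * c i.+2)%R = limbs s A 2 L.
  by apply: eq_bigr => i _; rewrite /c; do 3!f_equal; lia.
have -> : (\sum_(i < L) 'X^(s * i) * bpoly (new_limb v A (2 + Z.of_nat i)))%R = limbs s A' 2 L.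
  by apply: eq_bigr => i _; rewrite AE.
apply.
- by move=> i; apply: PE; exact: mod_limb.
- by move=> i; apply: PE; exact: div_limb.
- move=> i i2; have AQ0 : A (Z.of_nat i) = 0 by case: i i2 => [|[|]].
  by rewrite /P AQ0 clmul0 !Z.div_0_l ?Z.mod_0_l ?bpoly0 //; have := Q_gt0; lia.
- move=> i; rewrite /new_limb /P.
  have -> : 2 + Z.of_nat i - 1 = Z.of_nat i.+1 by lia.
  have -> : 2 + Z.of_nat i - 2 = Z.of_nat i by lia.
  have -> : 2 + Z.of_nat i = Z.of_nat i.+2 by lia.
  have lo q : limb (clmul (v mod Q) (A q) mod Q) by exact: mod_limb.
  have lo' q : limb (clmul (v / Q) (A q) mod Q) by exact: mod_limb.
  have hi q : limb (clmul (v mod Q) (A q) / Q).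
    by apply/div_limb/clmul_limbs => //; apply: mod_limb.
  have hi' q : limb (clmul (v / Q) (A q) / Q).
    by apply/div_limb/clmul_limbs => //; apply: div_limb.
  have ge0 z : limb z -> 0 <= z by case.
  by rewrite !bpoly_lxor //; do ?apply: ge0; do ?apply: lxor_limb.
Qed.

Lemma table_index a b : limb a -> limb b -> 0 <= a * Q + b < Q * Q.
Proof. by rewrite /limb; nia. Qed.

Lemma bounds : [/\ 0 < Q, 0 <= zn, 0 <= zk, 0 < zL & 0 <= zn * zL].
Proof. by split; try exact: Q_gt0; try lia; nia. Qed.

Lemma small_in_range z : 0 <= z <= B -> in_range W z.
Proof. by rewrite /in_range; have [] := bounds; lia. Qed.

Lemma small_index z : 0 <= z <= B -> index_ok W X z.
Proof. by rewrite /index_ok; have [] := bounds; lia. Qed.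

Lemma limb_in_range z : limb z -> in_range W z.
Proof. by move=> zQ; apply: small_in_range; have := limb_bound zQ; have [] := bounds; lia. Qed.

Lemma table_index_small a b : limb a -> limb b -> 0 <= a * Q + b <= B.
Proof. by move=> al bl; have := table_index al bl; have [] := bounds; lia. Qed.

(** Required at every index of the arrays [af], [ag], [acur] and [ares], also outside the rows in
    use, so that reading never needs an argument about what was written. *)
Definition limbed (st : state) : Prop := forall a q, (3 <= a < 7)%N -> limb (arr st a q).

Definition padded (st : state) : Prop := arr st acur 0 = 0 /\ arr st acur 1 = 0.

Ltac solve_limb :=
  first [ assumption | exact: mod_limb
        | apply: lxor_limb; solve_limb
        | apply: div_limb; apply: clmul_limbs; solve_limb ].

Ltac solve_range :=
  first [ exact: I | exact: erefl | lia
        | apply: small_in_range; lia | apply: small_index; lia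
        | apply: limb_in_range; solve_limb
        | apply: small_in_range; apply: table_index_small; solve_limb
        | apply: small_index; apply: table_index_small; solve_limb ].

Ltac split_ok :=
  lazymatch goal with
  | |- _ /\ _ => split; split_ok
  | |- and3 _ _ _ => split; split_ok
  | |- and4 _ _ _ _ => split; split_ok
  | |- and5 _ _ _ _ _ => split; split_ok
  | |- _ => idtac
  end.

Lemma multiply_cur_spec st (v : nat) : static st -> limbed st -> padded st -> (v < n)%N ->
  var st vlo = Z.of_nat v mod Q * Q -> var st vhi = Z.of_nat v / Q * Q ->
  hoare W X raw st multiply_cur (200 * zL + 20)
    (fun st' => [/\ limbed st', padded st'
       & eqXn (s * L) (limbs s (arr st' acur) 2 L)
           (bpoly (Z.of_nat v) * limbs s (arr st acur) 2 L)%R]).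
Proof.
move=> S lim [p0 p1] vn lo hi.
have Q0 := Q_gt0.
have vQ : 0 <= Z.of_nat v < Q * Q by lia.
have zL0 : 0 < zL by lia.
have znL : 0 <= zn * zL by nia.
have lm := mod_limb (Z.of_nat v).
have ld := div_limb vQ.
apply: hoare_set_seq; first by rewrite /= /in_range; lia.
set st0 := set_var _ _ _.
have S0 : static st0 by apply: static_set_var.
have aE : arr st0 acur = arr st acur by [].
(* Iteration [i] writes cell [L + 1 - i]: the cells above it are new, while that cell and the two
   below it, which the iteration reads, are still old. *)
pose pos z := zL + 1 - z.
pose reg (i : nat) q := (pos (Z.of_nat i) <? q) && (q <=? zL + 1).
have fill := @hoare_fill W X raw st0 vi vL acur
  ((EVar vL +e ECst 1) -e EVar vi) (mul_limb ((EVar vL +e ECst 1) -e EVar vi))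
  0 L pos (new_limb (Z.of_nat v) (arr st acur)) reg.
apply: hoare_weaken (fill _ _ _ _ _ _ _ _ _ _) _ _ => //; try by lia.
- by rewrite /= (static_L S).
- by move=> q; rewrite /reg /pos; lia.
- by move=> i q iL; rewrite /reg /pos; lia.
- move=> i st' iL F xi Ii.
  have S' : static st' by apply: static_frame F _ _ _.
  have lo' : var st' vlo = Z.of_nat v mod Q * Q by rewrite (frame_var F).
  have hi' : var st' vhi = Z.of_nat v / Q * Q by rewrite (frame_var F).
  have cur j : 0 <= j <= 2 ->
      arr st' acur (zL + 1 - Z.of_nat i - j) = arr st acur (zL + 1 - Z.of_nat i - j).
    by move=> j0; rewrite Ii /reg /pos; case: ifP => //; lia.
  have cur0 : arr st' acur (zL + 1 - Z.of_nat i) = arr st acur (zL + 1 - Z.of_nat i).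
    by have := cur 0; rewrite Z.sub_0_r; apply.
  rewrite /= lo' hi' (static_L S') (static_Q S') xi !cur // cur0.
  have tab := static_table S'.
  have l0 := lim acur (zL + 1 - Z.of_nat i) isT.
  have l1 := lim acur (zL + 1 - Z.of_nat i - 1) isT.
  have l2 := lim acur (zL + 1 - Z.of_nat i - 2) isT.
  rewrite !tab //.
  have xi1 : 0 <= zL + 1 - Z.of_nat i - 1 <= zL + 1 - Z.of_nat i by lia.
  by rewrite /pos; split_ok; solve_range.
- by rewrite /=; lia.
- move=> st' F E; have Enew q : 2 <= q <= zL + 1 ->
      arr st' acur q = new_limb (Z.of_nat v) (arr st acur) q.
    by move=> qL; rewrite E /reg /pos; case: ifP => //; lia.
  have Eold q : q < 2 -> arr st' acur q = arr st acur q.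
    by move=> qL; rewrite E /reg /pos; case: ifP => //; lia.
  split.
  + move=> a q aP; case: (eqVneq a acur) => [->|a5].
      rewrite E; case: ifP => _; last exact: lim.
      by apply: new_limb_limb => // q'; apply: lim.
    by rewrite (frame_arr F) /= ?mem_seq1 //; apply: lim.
  + by split; (rewrite Eold; [by [] | lia]).
  + apply: new_limb_mul => //; first by move=> q; apply: lim.
    by move=> i iL; rewrite Enew //; lia.
Qed.

Definition same_off (a : nat) (o : Z) (st st' : state) : Prop :=
  forall q, q < o \/ o + zL <= q -> arr st' a q = arr st a q.

(** The case of [hoare_fill] for one row. The body may use the old content of the cell that it
    overwrites, which covers all the in-place xor loops. *)
Lemma fill_seg st a e1 e2 o (f : nat -> Z) :
  static st -> var st vi = 0 -> (2 <= a)%N -> 0 <= o -> o + zL <= B ->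
  (expr_cost e1 + expr_cost e2 <= 180)%N ->
  (forall (i : nat) st', (i < L)%N -> frame [:: vi] [:: a] st st' -> static st' ->
     var st' vi = Z.of_nat i -> arr st' a (o + Z.of_nat i) = arr st a (o + Z.of_nat i) ->
     [/\ expr_ok W X raw e1 st', expr_val raw e1 st' = o + Z.of_nat i,
         expr_ok W X raw e2 st' & expr_val raw e2 st' = f i]) ->
  hoare W X raw st (CFor vi vL (CPut a e1 e2)) (200 * zL + 6)
    (fun st' => same_off a o st st' /\
       forall i : nat, (i < L)%N -> arr st' a (o + Z.of_nat i) = f i).
Proof.
move=> S i0 a2 o0 oB cost step; have [Q0 zn0 zk0 zL0 znL] := bounds.
pose reg (i : nat) q := (o <=? q) && (q <? o + Z.of_nat i).
have fill := @hoare_fill W X raw st vi vL a e1 e2 0 L (Z.add o)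
  (fun q => f (Z.to_nat (q - o))) reg.
apply: hoare_weaken (fill _ _ _ _ _ _ _ _ _ _) _ _ => //; try by lia.
- by rewrite (static_L S).
- by move=> q; rewrite /reg; lia.
- by move=> i q iL; rewrite /reg; lia.
- move=> i st' iL F xi Ii.
  have S' : static st'.
    by apply: static_frame F _ _ S => //=; rewrite !mem_seq1; lia.
  have old : arr st' a (o + Z.of_nat i) = arr st a (o + Z.of_nat i).
    by rewrite Ii /reg; case: ifP => //; lia.
  have [ok1 v1 ok2 v2] := step i st' iL F S' xi old.
  split=> //; first by apply: small_index; lia.
  by rewrite v2; congr f; lia.
- move=> st' F E; split=> [q Hq|i iL]; rewrite E /reg; case: ifP => //; try lia.
  by move=> _; congr f; lia.
Qed.

Definition row (a : nat) (st : state) (v : nat) : {poly 'F_2} :=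
  limbs s (arr st a) (Z.of_nat v * zL) L.

Lemma row_index (v : nat) i : (v < n)%N -> 0 <= i < zL ->
  0 <= Z.of_nat v * zL + i < zn * zL.
Proof. by move=> vn iL; split; nia. Qed.

Lemma row_end (v : nat) : (v < n)%N -> 0 <= Z.of_nat v * zL /\ Z.of_nat v * zL + zL <= B.
Proof.
move=> vn; have [Q0 zn0 zk0 zL0 znL] := bounds.
have : Z.of_nat v * zL + zL <= zn * zL by nia.
by split; [nia | lia].
Qed.

Lemma row_other a (u v : nat) st st' : same_off a (Z.of_nat v * zL) st st' -> u != v ->
  row a st' u = row a st u.
Proof.
move=> E uv; apply: eq_limbs => i iL; apply: E; move: uv; rewrite neq_ltn => /orP[uv|uv].
  by left; nia.
by right; nia.
Qed.

Lemma limbed_seg st st' a o (f : nat -> Z) : limbed st ->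
  (forall b, b != a -> arr st' b = arr st b) -> same_off a o st st' ->
  (forall i : nat, (i < L)%N -> arr st' a (o + Z.of_nat i) = f i) ->
  (forall i : nat, (i < L)%N -> limb (f i)) -> limbed st'.
Proof.
move=> lim E off Ef fl b q ab; case: (eqVneq b a) => [ba|ba]; last by rewrite E //; apply: lim.
rewrite {b}ba in ab *.
case: (Z_lt_dec q o) => [qo|qo]; first by rewrite off; [apply: lim | lia].
case: (Z_lt_dec q (o + zL)) => qo'; last by rewrite off; [apply: lim | lia].
have -> : q = o + Z.of_nat (Z.to_nat (q - o)) by lia.
by rewrite Ef; [apply: fl; lia | lia].
Qed.

Lemma clear_row_spec st (v : nat) a : static st -> (3 <= a < 7)%N -> (v < n)%N ->
  var st vrow = Z.of_nat v * zL -> limbed st ->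
  hoare W X raw st (clear_row a) (200 * zL + 20)
    (fun st' => [/\ limbed st', same_off a (Z.of_nat v * zL) st st'
       & row a st' v = 0%R]).
Proof.
move=> S a3 vn r lim; have [o0 oB] := row_end vn.
have [Q0 zn0 zk0 zL0 znL] := bounds.
apply: hoare_set_seq; first by rewrite /=; solve_range.
have S0 := static_set_var (x := vi) 0 S isT.
apply: hoare_weaken (@fill_seg (set_var st vi 0) a _ _ (Z.of_nat v * zL) (fun=> 0) S0 _ _ _ _ _ _) _ _ => //; try lia.
  move=> i st' iL F S' xi _; have r' : var st' vrow = Z.of_nat v * zL by rewrite (frame_var F).
  have := @row_index v (Z.of_nat i) vn.
  by rewrite /= r' xi => ri; split=> //; split_ok; solve_range.
  by rewrite /=; lia.
move=> st' F [off E]; split=> //.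
- apply: (limbed_seg (st := st) _ _ off E) => // b ba.
  by rewrite (frame_arr F) //= mem_seq1.
- by rewrite limbs_eq0 // => i iL; rewrite E // -Q_def; lia.
Qed.

Definition has_bits (b : nat -> bool) (st : state) : Prop :=
  forall j : nat, (j < k)%N -> arr st abit (Z.of_nat j) = Z.b2z (b j).

Definition current (st : state) : {poly 'F_2} := limbs s (arr st acur) 2 L.

Lemma limbs_b2z A C (b : bool) o o' :
  (forall i : nat, (i < L)%N -> C (o + Z.of_nat i) = Z.b2z b * A (o' + Z.of_nat i)) ->
  limbs s C o L = (b%:R * limbs s A o' L)%R.
Proof.
case: b => E.
  by rewrite mul1r; apply: eq_limbs => i /E ->; rewrite Z.mul_1_l.
rewrite mul0r limbs_eq0 => i /E -> //.
by rewrite Z.mul_0_l; lia.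
Qed.

Lemma b2z_limb (b : bool) z : limb z -> limb (Z.b2z b * z).
Proof. by case: b => /= zl; rewrite ?Z.mul_1_l ?Z.mul_0_l // /limb; have := Q_gt0; lia. Qed.

Lemma weigh_step_spec st (v j : nat) b : static st -> limbed st -> padded st ->
  has_bits b st -> (v < n)%N -> (j < k)%N -> var st vrow = Z.of_nat v * zL ->
  var st vlo = Z.of_nat v mod Q * Q -> var st vhi = Z.of_nat v / Q * Q ->
  var st vj = Z.of_nat j ->
  hoare W X raw st weigh_step (400 * zL + 60)
    (fun st' => [/\ limbed st', padded st', same_off ag (Z.of_nat v * zL) st st',
         row ag st' v = (row ag st v + (b j)%:R * current st)%R
       & eqXn (s * L) (current st') (bpoly (Z.of_nat v) * current st)%R]).
Proof.
move=> S lim pad bit vn jk r lo hi vjE; have [o0 oB] := row_end vn.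
have [Q0 zn0 zk0 zL0 znL] := bounds.
apply: hoare_set_seq; first by rewrite /=; solve_range.
have S0 := static_set_var (x := vi) 0 S isT.
pose f (i : nat) := Z.lxor (arr st ag (Z.of_nat v * zL + Z.of_nat i))
  (Z.b2z (b j) * arr st acur (2 + Z.of_nat i)).
have fl (i : nat) : limb (f i) by apply: lxor_limb; [apply: lim | apply/b2z_limb/lim].
apply: hoare_seq (@fill_seg (set_var st vi 0) ag _ _ (Z.of_nat v * zL) f S0 _ _ _ _ _ _) _ => //=.
  move=> i st' iL F S' xi old.
  have r' : var st' vrow = Z.of_nat v * zL by rewrite (frame_var F).
  have vj' : var st' vj = Z.of_nat j by rewrite (frame_var F).
  have bit' : arr st' abit (Z.of_nat j) = Z.b2z (b j) by rewrite (frame_arr F) //= bit.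
  have cur' q : arr st' acur q = arr st acur q by rewrite (frame_arr F).
  have ri := @row_index v (Z.of_nat i) vn ltac:(lia).
  have g1 := lim ag (Z.of_nat v * zL + Z.of_nat i) isT.
  have g2 := b2z_limb (b j) (lim acur (Z.of_nat i + 2) isT).
  rewrite r' xi vj' bit' cur' old; split_ok; try solve_range.
  by rewrite /f (Z.add_comm 2).
move=> st1 F [off E].
have S1 : static st1 by apply: static_frame F _ _ _.
have lim1 : limbed st1.
  apply: (limbed_seg (st := st) _ _ off E) => // c cP.
  by rewrite (frame_arr F) //= mem_seq1.
have pad1 : padded st1 by rewrite /padded !(frame_arr F).
apply: hoare_weaken (@multiply_cur_spec st1 v S1 lim1 pad1 vn _ _) _ _.
- by rewrite (frame_var F).
- by rewrite (frame_var F).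
- by lia.
move=> st2 F2 [lim2 pad2 E2]; split=> //.
- by move=> q qo; rewrite (frame_arr F2) // off.
- have -> : row ag st2 v = row ag st1 v by apply: eq_limbs => i iL; rewrite (frame_arr F2).
  (* The summand for bit [j] is stored nowhere; this function presents it as an array at the offset
     of the row. *)
  rewrite /row -(@limbs_b2z (arr st acur) (fun q => Z.b2z (b j) * arr st acur (q - Z.of_nat v * zL + 2)) _ (Z.of_nat v * zL)).
    apply: limbs_lxor => i iL; split.
    + by case: (lim ag (Z.of_nat v * zL + Z.of_nat i) isT).
    + by case: (b2z_limb (b j) (lim acur (Z.of_nat v * zL + Z.of_nat i - Z.of_nat v * zL + 2) isT)).
    + by rewrite E // /f; do 3!f_equal; lia.
  by move=> i iL; do 2!f_equal; lia.
- by move: E2; rewrite /current (frame_arr F).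
Qed.

Definition node_poly (v : nat) : {poly 'F_2} := bpoly (Z.of_nat v).

Lemma weigh_spec st (v : nat) b : static st -> limbed st -> padded st ->
  has_bits b st -> (v < n)%N -> var st vv = Z.of_nat v ->
  hoare W X raw st weigh ((zk + 1) * (400 * zL + 100) + 100)
    (fun st' => [/\ limbed st', padded st', same_off ag (Z.of_nat v * zL) st st'
       & eqXn (s * L) (row ag st' v) (vertex_weight node_poly k b v * row af st v)%R]).
Proof.
move=> S lim pad bit vn vvE; have [o0 oB] := row_end vn.
have [Q0 zn0 zk0 zL0 znL] := bounds.
have vn' : Z.of_nat v < zn by lia.
have nQQ : Z.of_nat v < Q * Q by lia.
have ml := mod_limb (Z.of_nat v); have dl : limb (Z.of_nat v / Q) by apply: div_limb; lia.
apply: hoare_set_seq; first by rewrite /= vvE (static_L S); split_ok; solve_range.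
rewrite /= vvE (static_L S); set st0 := set_var st _ _.
apply: hoare_set_seq; first by rewrite /=; solve_range.
set st1 := set_var st0 _ _.
have S1 : static st1 by do 2!apply: static_set_var => //.
pose f (i : nat) := arr st af (Z.of_nat v * zL + Z.of_nat i).
apply: hoare_seq (@fill_seg st1 acur _ _ 2 f S1 _ _ _ _ _ _) _ => //=; try lia.
  move=> i st' iL F S' xi old.
  have r' : var st' vrow = Z.of_nat v * zL by rewrite (frame_var F).
  have ri := @row_index v (Z.of_nat i) vn ltac:(lia).
  rewrite r' xi (frame_arr F) //=; split_ok; try solve_range.
move=> st2 F2 [off2 E2].
have S2 : static st2 by apply: static_frame F2 _ _ _.
have lim2 : limbed st2.
  apply: (limbed_seg (st := st) _ _ off2 E2) => // [c cP|i iL]; last exact: lim.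
  by rewrite (frame_arr F2) //= mem_seq1.
apply: hoare_seq (@clear_row_spec st2 v ag S2 isT vn _ lim2) _.
  by rewrite (frame_var F2).
move=> st3 F3 [lim3 off3 row3].
have S3 : static st3 by apply: static_frame F3 _ _ _.
have vv3 : var st3 vv = Z.of_nat v by rewrite (frame_var F3) // (frame_var F2).
have r3 : var st3 vrow = Z.of_nat v * zL by rewrite (frame_var F3) // (frame_var F2).
have m3 : 0 <= Z.of_nat v mod Q * Q <= B by rewrite /limb in ml; split; nia.
have d3 : 0 <= Z.of_nat v / Q * Q <= B by rewrite /limb in dl; split; nia.
apply: hoare_set_seq; first by rewrite /= vv3 (static_Q S3); split_ok; solve_range.
rewrite /= vv3 (static_Q S3).
apply: hoare_set_seq; first by rewrite /= vv3 (static_Q S3); split_ok; solve_range.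
rewrite /= vv3 (static_Q S3).
apply: hoare_set_seq; first by rewrite /=; split_ok; solve_range.
set st4 := set_var _ vj _.
have S4 : static st4 by do 3!apply: static_set_var => //.
(* The powers of the vertex polynomial are never formed by themselves: [acur] carries the [j]-th
   power times the row of [af], and [ag] collects the selected ones. *)
pose I (j : nat) st' := [/\ limbed st', padded st', same_off ag (Z.of_nat v * zL) st st',
   eqXn (s * L) (row ag st' v) ((\sum_(i < j) (b i)%:R * node_poly v ^+ i) * row af st v)%R
 & eqXn (s * L) (current st') (node_poly v ^+ j * row af st v)%R].
apply: hoare_weaken (@hoare_for W X raw st4 vj vk weigh_step 0 k
  (fun j => (400 * zL + 74) * Z.of_nat j) I _ _ _ _ _ _ _ _ _ _) _ _ => //=; try lia.
- by rewrite (static_k S3).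
- split=> //.
  + by case: pad => p0 p1; split; rewrite (frame_arr F3) //= off2 //; lia.
  + by move=> q qo; rewrite off3 // (frame_arr F2).
  + have -> : row ag st4 v = row ag st3 v by [].
    by rewrite row3 big_ord0 mul0r; exact: eqXn_refl.
  + rewrite expr0 mul1r; have -> : current st4 = row af st v; last exact: eqXn_refl.
    by apply: eq_limbs => i iL; rewrite /= (frame_arr F3) // E2.
- move=> j st' jk F xj [lim' pad' off' E' C'].
  have S' : static st' by apply: static_frame F _ _ _.
  have b' : has_bits b st'.
    by move=> i ik; rewrite (frame_arr F) //= (frame_arr F3) // (frame_arr F2) // bit.
  have jk' : (j < k)%N by lia.
  apply: hoare_weaken (weigh_step_spec S' lim' pad' b' vn jk' _ _ _ xj) _ _.
  + by rewrite (frame_var F).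
  + by rewrite (frame_var F).
  + by rewrite (frame_var F).
  + by rewrite Nat2Z.inj_succ; lia.
  move=> st5 F5 [lim5 pad5 off5 E5 C5]; split=> //.
  + by move=> q qo; rewrite /= off5 // off'.
  + have -> : forall st6 x z, row ag (set_var st6 x z) v = row ag st6 v by [].
    rewrite E5 big_ord_recr /= mulrDl; apply: eqXnD => //.
    by rewrite -mulrA; apply: eqXnM.
  + rewrite exprS -mulrA; apply: eqXn_trans C5 _; exact: eqXnM.
- by move=> st5 F5 [lim5 pad5 off5 E5 _]; split.
Qed.

Lemma take_adj_size (v : nat) : (v < n)%N ->
  sumn (map size (take v.+1 adj))
  = (sumn (map size (take v adj)) + size (nth [::] adj v))%N.
Proof.
move=> vn; have /andP[/eqP sz _] := adjP.
by rewrite (take_nth [::]) ?sz // map_rcons -cats1 sumn_cat /= addn0.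
Qed.

Lemma take_adj_le (v : nat) : (sumn (map size (take v adj)) <= m)%N.
Proof. by rewrite m_def /num_edges -{2}(cat_take_drop v adj) map_cat sumn_cat leq_addr. Qed.

Lemma nth_flatten_adj (v d : nat) : (v < n)%N -> (d < size (nth [::] adj v))%N ->
  nth 0%N (flatten adj) (sumn (map size (take v adj)) + d) = nth 0%N (nth [::] adj v) d.
Proof.
move=> vn dv; have /andP[/eqP sz _] := adjP.
rewrite -{1}(cat_take_drop v adj) flatten_cat nth_cat size_flatten /shape.
rewrite ltnNge leq_addr /= addKn (drop_nth [::]) ?sz //=.
by rewrite nth_cat dv.
Qed.

Let degree (v : nat) := size (nth [::] adj v).

(** The time is proportional to the degree plus one, so that the sum over all vertices is linear in
    [n + m]. *)
Lemma gather_spec st (v : nat) : static st -> limbed st -> (v < n)%N ->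
  var st vv = Z.of_nat v ->
  hoare W X raw st gather (Z.of_nat (degree v + 1) * (200 * zL + 100))
    (fun st' => [/\ limbed st', same_off af (Z.of_nat v * zL) st st'
       & row af st' v = \sum_(u <- nth [::] adj v) row ag st u]%R).
Proof.
move=> S lim vn vvE; have [o0 oB] := row_end vn.
have [Q0 zn0 zk0 zL0 znL] := bounds.
have vn' : Z.of_nat v < zn by lia.
have ts := take_adj_size vn; have le1 := take_adj_le v; have le2 := take_adj_le v.+1.
rewrite -/(degree v) in ts; set p0 := sumn _ in le1 ts; set p1 := sumn _ in le2 ts.
apply: hoare_set_seq; first by rewrite /= vvE (static_L S); split_ok; solve_range.
rewrite /= vvE (static_L S); set st0 := set_var st _ _.
have S0 : static st0 by apply: static_set_var => //.
apply: hoare_seq (@clear_row_spec st0 v af S0 isT vn _ lim) _ => //.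
move=> st1 F1 [lim1 off1 row1].
have S1 : static st1 by apply: static_frame F1 _ _ _.
have vv1 : var st1 vv = Z.of_nat v by rewrite (frame_var F1).
have r1 : var st1 vrow = Z.of_nat v * zL by rewrite (frame_var F1).
have in1 : arr st1 ainp (Z.of_nat v + 3) = Z.of_nat p0.
  by rewrite Z.add_comm (static_start S1) //; lia.
have in2 : arr st1 ainp (Z.of_nat v + 4) = Z.of_nat p1.
  by have := static_start S1 vn; rewrite -/p1 => <-; f_equal; lia.
apply: hoare_set_seq; first by rewrite /= vv1; split_ok; solve_range.
rewrite /= vv1 in1.
apply: hoare_set_seq; first by rewrite /= vv1; split_ok; solve_range.
rewrite /= vv1 in2.
set st2 := set_var _ vend _.
have S2 : static st2 by do 2!apply: static_set_var => //.
pose I (p : nat) st' := [/\ limbed st', same_off af (Z.of_nat v * zL) st st'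
   & row af st' v = \sum_(u <- take (p - p0) (nth [::] adj v)) row ag st u]%R.
apply: hoare_weaken (@hoare_for W X raw st2 vp vend gather_step p0 p1
  (fun j => (200 * zL + 50) * Z.of_nat j) I _ _ _ _ _ _ _ _ _ _) _ _ => //=; try lia.
- split=> //; last by rewrite subnn take0 big_nil.
- move=> p st' pP F xp [lim' off' E'].
  have S' : static st' by apply: static_frame F _ _ _.
  have r' : var st' vrow = Z.of_nat v * zL by rewrite (frame_var F).
  have pm : (p < m)%N by lia.
  pose u := nth 0%N (nth [::] adj v) (p - p0).
  have pd : (p - p0 < degree v)%N by lia.
  have un : (u < n)%N by apply: (adj_lt adjP (v := v)); apply: mem_nth.
  have tE : arr st' ainp (Z.of_nat p + (zn + 4)) = Z.of_nat u.
    have := static_target S' pm; rewrite -(subnKC (_ : p0 <= p)%N); last by lia.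
    by rewrite nth_flatten_adj // => <-; f_equal; lia.
  have [u0 uB] := row_end un.
  apply: hoare_set_seq.
    by rewrite /= xp (static_n S') tE (static_L S'); split_ok; solve_range.
  rewrite /= xp (static_n S') tE (static_L S').
  apply: hoare_set_seq; first by rewrite /=; split_ok; solve_range.
  set st3 := set_var _ _ _.
  have S3 : static st3 by do 2!apply: static_set_var => //.
  pose f (i : nat) := Z.lxor (arr st' af (Z.of_nat v * zL + Z.of_nat i))
    (arr st' ag (Z.of_nat u * zL + Z.of_nat i)).
  have fl (i : nat) : limb (f i) by apply: lxor_limb; apply: lim'.
  apply: hoare_weaken (@fill_seg st3 af _ _ (Z.of_nat v * zL) f S3 _ _ _ _ _ _) _ _ => //=; try lia.
    move=> i st6 iL F6 S6 xi old.
    have r6 : var st6 vrow = Z.of_nat v * zL by rewrite (frame_var F6).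
    have w6 : var st6 vrow' = Z.of_nat u * zL by rewrite (frame_var F6).
    have ri := @row_index v (Z.of_nat i) vn ltac:(lia).
    have ru := @row_index u (Z.of_nat i) un ltac:(lia).
    have g1 := lim' af (Z.of_nat v * zL + Z.of_nat i) isT.
    have g2 := lim' ag (Z.of_nat u * zL + Z.of_nat i) isT.
    by rewrite r6 w6 xi old (frame_arr F6) //=; split_ok; solve_range.
  move=> st7 F7 [off7 E7]; split.
  + apply: (limbed_seg (st := st') (a := af) _ _ off7 E7) => // c cP.
    by rewrite /= (frame_arr F7) //= mem_seq1.
  + by move=> q qo; rewrite /= off7 // off'.
  + rewrite subSn; last by lia.
    rewrite (take_nth 0%N) // -cats1 big_cat big_seq1 -E' /=.
    have -> : row ag st (nth 0%N (nth [::] adj v) (p - p0)) = row ag st' u.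
      rewrite /row (frame_arr F) //= (frame_arr F1) //.
    apply: limbs_lxor => i iL; split; rewrite /= ?E7 //.
      by case: (lim' af (Z.of_nat v * zL + Z.of_nat i) isT).
    by case: (lim' ag (Z.of_nat u * zL + Z.of_nat i) isT).
- by move=> st5 F5 [lim5 off5 E5]; split=> //; rewrite E5 ts addKn take_size.
Qed.

Let zm := Z.of_nat m.

Lemma walk_step_spec st b (c F : nat -> {poly 'F_2}) :
  static st -> limbed st -> padded st -> has_bits b st ->
  (forall v, c v = vertex_weight node_poly k b v) ->
  (forall v : nat, (v < n)%N -> eqXn (s * L) (row af st v) (F v)) ->
  hoare W X raw st walk_step
    (zn * ((zk + 1) * (400 * zL + 100) + 114) + (zn + zm) * (200 * zL + 114) + 30)
    (fun st' => [/\ limbed st', padded st',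
      forall v : nat, (v < n)%N -> eqXn (s * L) (row ag st' v) (c v * F v)%R
    & forall v : nat, (v < n)%N ->
        eqXn (s * L) (row af st' v) (\sum_(u <- nth [::] adj v) c u * F u)%R]).
Proof.
move=> S lim pad bit cE FE; have [Q0 zn0 zk0 zL0 znL] := bounds.
apply: hoare_set_seq; first by rewrite /=; solve_range.
set st0 := set_var _ _ _.
have S0 : static st0 by apply: static_set_var => //.
pose I (i : nat) st' := [/\ limbed st', padded st'
  & forall v : nat, (v < i)%N -> eqXn (s * L) (row ag st' v) (c v * F v)%R].
apply: hoare_seq (@hoare_for W X raw st0 vv vn weigh 0 n
  (fun j => ((zk + 1) * (400 * zL + 100) + 114) * Z.of_nat j) I _ _ _ _ _ _ _ _ _ _) _ => //=; try lia.
- by rewrite (static_n S).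
- move=> i st' iP F1 xi [lim' pad' E'].
  have S' : static st' by apply: static_frame F1 _ _ _.
  have b' : has_bits b st' by move=> j jk; rewrite (frame_arr F1) //= bit.
  have iln : (i < n)%N by lia.
  apply: hoare_weaken (weigh_spec S' lim' pad' b' iln xi) _ _.
    by rewrite Nat2Z.inj_succ; lia.
  move=> st2 F2 [lim2 pad2 off2 E2]; split=> // v vi.
  have -> : forall st6 x z, row ag (set_var st6 x z) v = row ag st6 v by [].
  case: (eqVneq v i) => [->|vni]; last by rewrite (row_other off2) //; apply: E'; lia.
  apply: eqXn_trans E2 _; rewrite cE; apply: eqXnM.
  by rewrite /row (frame_arr F1) //=; apply: FE.
move=> st1 F1 [lim1 pad1 E1].
have S1 : static st1 by apply: static_frame F1 _ _ _.
apply: hoare_set_seq; first by rewrite /=; solve_range.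
set st2 := set_var _ _ _.
have S2 : static st2 by apply: static_set_var => //.
(* The loop time is measured by the vertices and list entries already passed. It telescopes to
   [n + m] although the degrees vary. *)
pose start v := sumn (map size (take v adj)).
pose J (i : nat) st' := limbed st' /\
  forall v : nat, (v < i)%N ->
    eqXn (s * L) (row af st' v) (\sum_(u <- nth [::] adj v) c u * F u)%R.
apply: hoare_weaken (@hoare_for W X raw st2 vv vn gather 0 n
  (fun j => (200 * zL + 114) * (Z.of_nat j + Z.of_nat (start j))) J _ _ _ _ _ _ _ _ _ _) _ _ => //=; try lia.
- by rewrite (static_n S1).
- move=> i st' iP F2 xi [lim' E'].
  have S' : static st' by apply: static_frame F2 _ _ _.
  have iln : (i < n)%N by lia.
  apply: hoare_weaken (gather_spec S' lim' iln xi) _ _.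
    rewrite /start take_adj_size // /degree; nia.
  move=> st3 F3 [lim3 off3 E3]; split=> // v vi.
  have -> : forall st6 x z, row af (set_var st6 x z) v = row af st6 v by [].
  case: (eqVneq v i) => [->|vni]; last by rewrite (row_other off3) //; apply: E'; lia.
  rewrite E3; apply: eqXn_sum => u /(adj_lt adjP) un.
  by rewrite /row (frame_arr F2) //=; apply: E1.
- by rewrite /start take0 /= /zm m_def /num_edges take_oversize; [nia | case/andP: adjP => /eqP ->].
- move=> st3 F3 [lim3 E3]; split=> //.
  + by rewrite /padded (frame_arr F3).
  + by move=> v vn; rewrite /row (frame_arr F3) //=; apply: E1.
Qed.

Definition result (st : state) : {poly 'F_2} := limbs s (arr st ares) 0 L.

Lemma collect_spec st : static st -> limbed st -> padded st -> var st vv = 0 ->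
  hoare W X raw st (CFor vv vn collect) (zn * (200 * zL + 40) + 10)
    (fun st' => [/\ limbed st', padded st'
      & result st' = result st + \sum_(v < n) row ag st v]%R).
Proof.
move=> S lim pad vv0; have [Q0 zn0 zk0 zL0 znL] := bounds.
pose I (i : nat) st' := [/\ limbed st', padded st'
  & result st' = result st + \sum_(v < i) row ag st v]%R.
apply: hoare_weaken (@hoare_for W X raw st vv vn collect 0 n
  (fun j => (200 * zL + 40) * Z.of_nat j) I _ _ _ _ _ _ _ _ _ _) _ _ => //=; try lia.
- by rewrite (static_n S).
- by split=> //; rewrite big_ord0 addr0.
move=> v st' iP F xi [lim' pad' E'].
have S' : static st' by apply: static_frame F _ _ _.
have vn' : (v < n)%N by lia.
have [o0 oB] := row_end vn'.
apply: hoare_set_seq; first by rewrite /= xi (static_L S'); split_ok; solve_range.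
rewrite /= xi (static_L S').
apply: hoare_set_seq; first by rewrite /=; split_ok; solve_range.
set st1 := set_var _ vi _.
have S1 : static st1 by do 2!apply: static_set_var => //.
pose f (i : nat) := Z.lxor (arr st' ares (Z.of_nat i))
    (arr st' ag (Z.of_nat v * zL + Z.of_nat i)).
have fl (i : nat) : limb (f i) by apply: lxor_limb; apply: lim'.
apply: hoare_weaken (@fill_seg st1 ares _ _ 0 f S1 _ _ _ _ _ _) _ _ => //=; try lia.
  move=> i st6 iL F6 S6 xi6; rewrite !Z.add_0_l => old.
  have r6 : var st6 vrow = Z.of_nat v * zL by rewrite (frame_var F6).
  have ri := @row_index v (Z.of_nat i) vn' ltac:(lia).
  have g1 := lim' ares (Z.of_nat i) isT.
  have g2 := lim' ag (Z.of_nat v * zL + Z.of_nat i) isT.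
  by rewrite r6 xi6 old (frame_arr F6) //=; split_ok; solve_range.
move=> st7 F7 [off7 E7]; split.
- apply: (limbed_seg (st := st') (a := ares) _ _ off7 E7) => // c cP.
  by rewrite /= (frame_arr F7) //= mem_seq1.
- by rewrite /padded /= (frame_arr F7).
- rewrite big_ord_recr addrA /= -E' /=.
  have -> : row ag st v = row ag st' v by rewrite /row (frame_arr F).
  apply: limbs_lxor => i iL; split; rewrite /= ?E7 //.
    by case: (lim' ares (0 + Z.of_nat i) isT).
  by case: (lim' ag (Z.of_nat v * zL + Z.of_nat i) isT).
Qed.

Local Arguments Z.b2z : simpl never.

Lemma b2z_range (x : bool) : in_range W (Z.b2z x).
Proof. by apply: small_in_range; have [] := bounds; case: x; rewrite /Z.b2z; nia. Qed.

Lemma increment_spec st c : static st -> has_bits (nat_bit c) st -> (c < 2 ^ k)%N ->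
  hoare W X raw st increment (zk * 80 + 40)
    (fun st' => has_bits (nat_bit c.+1) st' /\
       var st' vc = Z.b2z (c.+1 < 2 ^ k)%N).
Proof.
move=> S bit ck; have [Q0 zn0 zk0 zL0 znL] := bounds.
apply: hoare_set_seq; first by rewrite /=; solve_range.
apply: hoare_set_seq; first by rewrite /=; solve_range.
set st0 := set_var _ vj _.
have S0 : static st0 by do 2!apply: static_set_var => //.
(* Bits below [j] already belong to [c + 1], the others still to [c], and the carry [r] is the
   difference of the two numbers shifted right by [j]. *)
pose I (j : nat) st' := (forall i : nat, (i < k)%N ->
    arr st' abit (Z.of_nat i) = Z.b2z (nat_bit (if (i < j)%N then c.+1 else c) i)) /\
  exists2 r : bool, var st' vc = Z.b2z r & (c.+1 %/ 2 ^ j = c %/ 2 ^ j + r)%N.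
apply: hoare_seq (@hoare_for W X raw st0 vj vk increment_step 0 k
  (fun j => 80 * Z.of_nat j) I _ _ _ _ _ _ _ _ _ _) _ => //=; try lia.
- by rewrite (static_k S).
- split=> //.
  by exists true => //=; rewrite expn0 !divn1 addn1.
- move=> j st' jk F xj [bits [r rE cE]].
  have jk' : (j < k)%N by lia.
  have bj := bits _ jk'; rewrite ltnn /nat_bit in bj.
  apply: hoare_set_seq; first by rewrite /= xj; split_ok; solve_range.
  rewrite /= xj bj.
  apply: hoare_put_seq; rewrite /= ?rE ?xj; try solve_range.
    by split_ok; try solve_range; rewrite b2z_lxor; exact: b2z_range.
  apply: hoare_set.
  + by rewrite /= rE b2z_mul; split_ok; try exact: b2z_range; solve_range.
  + rewrite /= rE b2z_mul b2z_lxor; split.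
      move=> i ik /=; case: Z.eqb_spec => [ij|ij].
        have -> : i = j by lia.
        rewrite leqnn /nat_bit cE oddD; by case: (r).
      rewrite bits //; do 2!f_equal.
      have -> : (i < j.+1)%N = (i < j)%N by lia.
      by [].
    exists (odd (c %/ 2 ^ j) && r) => //.
    rewrite expnSr !divnMA cE !divn2.
    by rewrite -{1}(odd_double_half (c %/ 2 ^ j)); case: odd; case: (r) => /=; lia.
  + by rewrite /=; lia.
move=> st1 F1 [bits [r rE cE]].
apply: hoare_set.
- by rewrite /= rE; split_ok; try solve_range; case: (r); rewrite /Z.b2z; solve_range.
- split; first by move=> i ik; rewrite /= bits // ik.
  rewrite /= rE; move: cE; rewrite (divn_small ck) add0n; case: ltnP => H.
    by rewrite divn_small // => r0; case: (r) r0.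
  have -> : c.+1 = (2 ^ k)%N by apply/eqP; rewrite eqn_leq ck H.
  by rewrite divnn expn_gt0 /= => r1; case: (r) r1.
- by rewrite /=; lia.
Qed.

Lemma init_rows_spec st : static st -> limbed st -> var st vi = 0 ->
  hoare W X raw st (CFor vi vnL (CPut af (EVar vi) (EVar vi %e EVar vL <e ECst 1)))
    (200 * (zn * zL) + 6)
    (fun st' => limbed st' /\ forall v : nat, (v < n)%N -> row af st' v = 1%R).
Proof.
move=> S lim i0; have [Q0 zn0 zk0 zL0 znL] := bounds.
pose f q := if q mod zL <? 1 then 1 else 0.
pose reg (i : nat) q := (0 <=? q) && (q <? Z.of_nat i).
have fill := @hoare_fill W X raw st vi vnL af (EVar vi) (EVar vi %e EVar vL <e ECst 1)
  0 (n * L) id f reg.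
apply: hoare_weaken (fill _ _ _ _ _ _ _ _ _ _) _ _ => //; try by nia.
- by rewrite (static_nL S); lia.
- by move=> q; rewrite /reg; lia.
- by move=> i q iL; rewrite /reg; lia.
- move=> i st' iL F xi Ii.
  have S' : static st' by apply: static_frame F _ _ _.
  have i1 : 0 <= Z.of_nat i <= B by nia.
  have := Z.mod_pos_bound (Z.of_nat i) zL zL0.
  have zLB : zL <= B by lia.
  rewrite /= xi (static_L S') => mb; split_ok; solve_range.
move=> st' F E.
have off a : a != af -> arr st' a = arr st a by move=> aP; rewrite (frame_arr F) //= mem_seq1.
have E1 v i : (v < n)%N -> (i < L)%N ->
    arr st' af (Z.of_nat v * zL + Z.of_nat i) = if i == 0%N then 1 else 0.
  move=> vn iL; rewrite E /reg; have := @row_index v (Z.of_nat i) vn ltac:(lia).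
  case: ifP => [_ _|]; last by move=> ? ?; nia.
  rewrite /f Z.add_comm Z.mod_add ?Z.mod_small; try lia.
  by case: Z.ltb_spec; case: eqP; lia.
split=> [a q aP|v vn].
  case: (eqVneq a af) => [aE|aE]; last by rewrite off //; apply: lim.
  rewrite aE E /reg /f; case: ifP => [qP|_]; last exact: lim.
  case: ifP => _; rewrite /limb; try lia; split; try lia.
  (* The written value 1 is a limb only if [Q > 1]. Some cell has been written, so [n > 0], and then
     [n < Q * Q] excludes [Q = 1]. *)
  suff : 1 < Q * Q by nia.
  suff : 0 < zn by lia.
  by nia.
rewrite /row /limbs -(prednK L_gt0) big_ord_recl /= E1 //= muln0 expr0 bpoly1 big1 ?addr0 ?mul1r //.
by move=> i _; rewrite E1 ?bpoly0 ?mulr0 //= /bump; have := ltn_ord i; lia.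
Qed.

Definition walk_time : Z :=
  zn * ((zk + 1) * (400 * zL + 100) + 114) + (zn + zm) * (200 * zL + 114) + 30.

Definition round_time : Z :=
  200 * (zn * zL) + zk * (walk_time + 14) + zn * (200 * zL + 40) + zk * 80 + 95.

Lemma round_spec st c : static st -> limbed st -> padded st ->
  has_bits (nat_bit c) st -> (c < 2 ^ k)%N ->
  hoare W X raw st round round_time
    (fun st' => [/\ limbed st', padded st', has_bits (nat_bit c.+1) st',
        var st' vc = Z.b2z (c.+1 < 2 ^ k)%N
      & (0 < k)%N -> eqXn (s * L) (result st')
          (result st + weighted_walks n adj node_poly k (nat_bit c))%R]).
Proof.
move=> S lim pad bit ck; have [Q0 zn0 zk0 zL0 znL] := bounds.
pose wc := vertex_weight node_poly k (nat_bit c).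
apply: hoare_set_seq; first by rewrite /=; solve_range.
have S0 := static_set_var (x := vi) 0 S isT.
apply: hoare_seq (init_rows_spec S0 lim _) _ => //.
move=> st1 F1 [lim1 one1].
have S1 : static st1 by apply: static_frame F1 _ _ _.
apply: hoare_set_seq; first by rewrite /=; solve_range.
set st2 := set_var _ _ _.
have S2 : static st2 by apply: static_set_var.
(* [ag] lags one step behind [af]: it holds the weighted values before the last summation over
   neighbours. The total over [ag] therefore counts walks with [t] weighted vertices. *)
pose I (t : nat) st' := [/\ limbed st', padded st',
    forall v : nat, (v < n)%N -> eqXn (s * L) (row af st' v) (walk_sum adj wc t v)
  & forall v : nat, (v < n)%N -> (0 < t)%N ->
      eqXn (s * L) (row ag st' v) (wc v * walk_sum adj wc t.-1 v)%R].
apply: hoare_seq (@hoare_for W X raw st2 vt vk walk_step 0 k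
  (fun j => (walk_time + 14) * Z.of_nat j) I _ _ _ _ _ _ _ _ _ _) _ => //=; try lia.
- by rewrite (static_k S1).
- split=> //; first by rewrite /padded /= (frame_arr F1).
  by move=> v vn; rewrite [row _ _ _](one1 v vn); exact: eqXn_refl.
- move=> t st' tP F xt [lim' pad' Ef Eg].
  have S' : static st' by apply: static_frame F _ _ _.
  have b' : has_bits (nat_bit c) st'.
    by move=> j jk; rewrite (frame_arr F) //= (frame_arr F1) //= bit.
  apply: hoare_weaken (@walk_step_spec st' (nat_bit c) wc (walk_sum adj wc t) S' lim' pad' b' _ Ef) _ _ => //.
    by rewrite -/walk_time Nat2Z.inj_succ; lia.
  by move=> st3 F3 [lim3 pad3 Eg3 Ef3]; split=> // v vn _; exact: Eg3.
move=> st3 F3 [lim3 pad3 Ef3 Eg3].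
have S3 : static st3 by apply: static_frame F3 _ _ _.
apply: hoare_set_seq; first by rewrite /=; solve_range.
set st4 := set_var _ _ _.
have S4 : static st4 by apply: static_set_var.
apply: hoare_seq (@collect_spec st4 S4 lim3 pad3 _) _ => //.
move=> st5 F5 [lim5 pad5 E5].
have S5 : static st5 by apply: static_frame F5 _ _ _.
have b5 : has_bits (nat_bit c) st5.
  move=> j jk; rewrite (frame_arr F5) //= (frame_arr F3) //= (frame_arr F1) //=.
  exact: bit.
apply: hoare_weaken (increment_spec S5 b5 ck) _ _.
  by rewrite /= /round_time; lia.
move=> st6 F6 [b6 c6]; split=> //.
- move=> a q aP; rewrite (frame_arr F6) /=; first exact: lim5.
  by rewrite mem_seq1; lia.
- by rewrite /padded (frame_arr F6).
- move=> k0; rewrite {1}/result (frame_arr F6) // -/(result st5) E5.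
  apply: eqXnD; last first.
    apply: eqXn_sum => v _; apply: Eg3 => //; exact: ltn_ord.
  rewrite /result /= (frame_arr F3) // /= (frame_arr F1) //; exact: eqXn_refl.
Qed.

(** * Reading off the answer *)

Hypothesis kn : (k <= n)%N.
Hypothesis L_def : L = (2 * k * k + 1)%N.
Hypothesis one_path : (num_kpaths n k adj <= 1)%N.

(** Vertex numbers have at most [2 s] bits, and there are at most [k^2] factors of degree below
    [2 s]; this is the origin of [L = 2 k^2 + 1]. The case [s = 0] would force [n = 0], against
    [0 < k <= n]. *)
Lemma size_path_vandermonde (w : k.-tuple 'I_n) : (0 < k)%N ->
  (size (path_vandermonde node_poly w) <= s * L)%N.
Proof.
move=> k0; have s0 : (0 < s)%N by have := nQ; rewrite Q_def; case: (s) => //; lia.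
have szn (v : 'I_n) : (size (node_poly v) <= (2 * s).-1.+1)%N.
  rewrite prednK; last by lia.
  apply: size_bpoly; have -> : Z.of_nat (2 * s) = Z.of_nat s + Z.of_nat s by lia.
  by rewrite Z.pow_add_r -?Q_def; have := ltn_ord v; lia.
have : (size (path_vandermonde node_poly w) <= (k * (k * (2 * s).-1)).+1)%N.
  apply: size_prod_bound => [i _|]; last by rewrite card_ord.
  apply: size_prod_bound => [j _|]; last by apply: leq_trans (max_card _) _; rewrite card_ord.
  by apply: leq_trans (size_polyD _ _) _; rewrite geq_max !szn.
by rewrite L_def; nia.
Qed.

Lemma node_poly_inj : {in gtn n &, injective node_poly}.
Proof. by move=> u v _ _ /bpoly_inj; lia. Qed.

(** The result is known only modulo [X^(s L)], but both it and the sieve value lie below that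
    degree, so the zero test is exact. *)
Lemma result_eq0 st : (0 < k)%N -> limbed st ->
  eqXn (s * L) (result st) (sieve n adj node_poly k) ->
  result st = 0%R <-> ~~ has_kpath n k adj.
Proof.
move=> k0 lim E.
have szr : (size (result st) <= s * L)%N.
  by apply: size_limbs => i iL; rewrite -Q_def; apply: lim.
have := @sieve_has_kpath _ pchar_polyF2 n adj node_poly adjP k.-1.
rewrite prednK // => /(_ one_path); case: has_kpath => [[w wU sE]|s0]; last first.
  by rewrite s0 in E; split=> // _; apply/(eqXn_eq0 szr _ E); rewrite ?size_poly0.
split=> // r0; have szV := size_path_vandermonde w k0.
rewrite r0 -sE in E szV; have /eqP := path_vandermonde_neq0 pchar_polyF2 node_poly_inj wU.
by rewrite -sE; case; apply/(eqXn_eq0 _ szV E); rewrite ?size_poly0.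
Qed.

Definition search_time : Z := 2 ^ zk * (round_time + 5) + 100 * zL + 100.

Lemma search_spec st : static st -> limbed st -> padded st ->
  (forall j : nat, (j < k)%N -> arr st abit (Z.of_nat j) = 0) ->
  result st = 0%R -> var st vans = Z.b2z (k == 0)%N ->
  hoare W X raw st search search_time
    (fun st' => var st' vn = Z.b2z (has_kpath n k adj)).
Proof.
move=> S lim pad bit0 res0 ans0; have [Q0 zn0 zk0 zL0 znL] := bounds.
have pk : (0 < 2 ^ k)%N by rewrite expn_gt0.
apply: hoare_set_seq; first by rewrite /=; solve_range.
set st0 := set_var _ _ _.
have S0 : static st0 by apply: static_set_var.
pose I (c : nat) st' := [/\ limbed st', padded st', has_bits (nat_bit c) st',
    var st' vc = Z.b2z (c < 2 ^ k)%N
  & (0 < k)%N -> eqXn (s * L) (result st')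
      (\sum_(0 <= c' < c) weighted_walks n adj node_poly k (nat_bit c'))%R].
have while := @hoare_while W X raw st0 (EVar vc) round 0 (2 ^ k)
  (fun j => (round_time + 5) * Z.of_nat j) I (leq0n _).
apply: hoare_seq (while _ _ _) _.
- split=> //.
  + by move=> j jk; rewrite /= bit0 // /nat_bit div0n.
  + by rewrite pk.
  + by move=> k0; rewrite big_geq // -res0; exact: eqXn_refl.
- move=> c st' /= cP F [lim' pad' b' c' E'].
  have S' : static st' by apply: static_frame F _ _ _.
  split=> //; first by rewrite c' cP.
  apply: hoare_weaken (round_spec S' lim' pad' b' cP) _ _.
    by rewrite Nat2Z.inj_succ /=; lia.
  move=> st1 F1 [lim1 pad1 b1 c1 E1]; split=> // k0.
  rewrite big_nat_recr //=; apply: eqXn_trans (E1 k0) _.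
  by apply: eqXnD; [exact: E' | exact: eqXn_refl].
- by move=> st' F [_ _ _ c' _]; split=> //=; rewrite c' ltnn.
move=> st1 F1 [lim1 pad1 _ _ E1].
have S1 : static st1 by apply: static_frame F1 _ _ _.
have ans1 : var st1 vans = Z.b2z (k == 0)%N by rewrite (frame_var F1).
apply: hoare_set_seq; first by rewrite /=; solve_range.
set st2 := set_var _ _ _.
have S2 : static st2 by apply: static_set_var.
(* The disjunct [k = 0] comes from the initial value of [vans]. It overrides the sieve, whose result
   is specified only for [0 < k]. *)
pose J (i : nat) st' := exists2 r : bool, var st' vans = Z.b2z r &
  r <-> k = 0%N \/ exists2 i' : nat, (i' < i)%N & arr st1 ares (Z.of_nat i') <> 0.
apply: hoare_seq (@hoare_for W X raw st2 vi vL _ 0 L (fun j => 80 * Z.of_nat j) J _ _ _ _ _ _ _ _ _ _) _ => //=; try lia.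
- by rewrite (static_L S1).
- exists (k == 0)%N => //; split=> [/eqP k0|[->|[]]] //; by left.
- move=> i st' iP F xi [r rE rP].
  have aE : arr st' ares (Z.of_nat i) = arr st1 ares (Z.of_nat i) by rewrite (frame_arr F).
  have l1 := lim1 ares (Z.of_nat i) isT.
  have lB := limb_bound l1.
  apply: hoare_set; last by rewrite /=; lia.
    by rewrite /= xi aE rE; split_ok; try solve_range; case: (r); rewrite /Z.b2z; solve_range.
  exists (r || ~~ (arr st1 ares (Z.of_nat i) =? 0)).
    rewrite /= rE xi aE /limb in l1 *.
    rewrite /Z.b2z; case: (r) => /=; case: Z.ltb_spec => ?; try case: Z.eqb_spec => ? /=; lia.
  split.
    case/orP => [/rP[k0|[i' ii i'0]]|/negbTE/Z.eqb_neq i0]; first by left.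
      by right; exists i' => //; lia.
    by right; exists i.
  case=> [k0|[i' ii i'0]]; apply/orP; first by left; apply/rP; left.
  case: (eqVneq i' i) => [ii'|ii']; first by right; rewrite -ii'; apply/negP => /Z.eqb_eq.
  by left; apply/rP; right; exists i' => //; lia.
move=> st3 F3 [r rE rP].
apply: hoare_set => //=; last first.
  by rewrite /search_time zk_def zpow2_nat; lia.
rewrite rE; congr Z.b2z; apply/idP/idP.
  move/rP=> [k0|[i iL i0]].
    by move: one_path; rewrite k0 => _; exact: has_kpath0.
  case: (posnP k) => [->|k0]; first exact: has_kpath0.
  apply: contraT => nP; case: i0.
  have r0 : result st1 = 0%R by apply: (proj2 (result_eq0 k0 lim1 (E1 k0))).
  have lk : limbs_ok s (arr st1 ares) 0 L by move=> j jL; rewrite -Q_def; apply: lim1.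
  by have := proj1 (limbs_eq0 lk) r0 _ iL; rewrite Z.add_0_l.
move=> P; apply/rP; case: (posnP k) => [->|k0]; [by left | right].
have [/forallP z|/forallPn[i /negbTE/Z.eqb_neq iP]] :=
  boolP [forall i : 'I_L, arr st1 ares (Z.of_nat i) =? 0]; last by exists i.
have /(result_eq0 k0 lim1 (E1 k0)) : result st1 = 0%R; last by rewrite P.
apply/limbs_eq0 => i iL; first by rewrite -Q_def; apply: lim1.
by have /Z.eqb_eq := z (Ordinal iL).
Qed.

Hypothesis Q_min : forall j : nat, (j < s)%N -> 2 ^ Z.of_nat j * 2 ^ Z.of_nat j <= zn.

Lemma input_start (v : nat) : (v <= n)%N ->
  raw (3 + Z.of_nat v) = Z.of_nat (sumn (map size (take v adj))).
Proof.
move=> vn; rewrite /input /input_mem; have -> : Z.to_nat (3 + Z.of_nat v) = v.+3 by lia.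
by rewrite /= subSS subSS subSS subn0; have -> : (v.+3 <= 3 + n)%N by lia.
Qed.

Lemma input_target (p : nat) : (p < m)%N ->
  raw (4 + zn + Z.of_nat p) = Z.of_nat (nth 0%N (flatten adj) p).
Proof.
move=> pm; rewrite /input /input_mem -m_def.
have -> : Z.to_nat (4 + zn + Z.of_nat p) = (4 + n + p)%N by lia.
have -> : (3 <= 4 + n + p <= 3 + n)%N = false by lia.
have -> : (4 + n <= 4 + n + p < 4 + n + m)%N by lia.
by rewrite addKn.
Qed.

Definition setup_time : Z := 200 * (zn + zm) + 100 * zn + 200 * (Q * Q) + 300.

Lemma table_spec st : var st vQ = Q -> var st vi = 0 -> var st vQQ = Q * Q ->
  (forall q, arr st atab q = 0) ->
  hoare W X raw st
    (CFor vi vQQ (CPut atab (EVar vi)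
      (ECst 2 *e EArr atab ((EVar vi -e EVar vi %e EVar vQ) +e (EVar vi %e EVar vQ) /e ECst 2)
       ^e ((EVar vi %e EVar vQ) %e ECst 2) *e (EVar vi /e EVar vQ))))
    (200 * (Q * Q) + 6)
    (fun st' => forall a b, 0 <= a < Q -> 0 <= b < Q ->
       arr st' atab (a * Q + b) = clmul a b).
Proof.
move=> vQE vi0 vQQE tab0; have [Q0 zn0 zk0 zL0 znL] := bounds.
pose f q := clmul (q / Q) (q mod Q).
pose reg (i : nat) q := (0 <=? q) && (q <? Z.of_nat i).
have QQ0 : 0 <= Q * Q by nia.
have QQE : Z.of_nat (Z.to_nat (Q * Q)) = Q * Q by lia.
have QB : Q <= B by nia.
have fill := @hoare_fill W X raw st vi vQQ atab (EVar vi)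
  (ECst 2 *e EArr atab ((EVar vi -e EVar vi %e EVar vQ) +e (EVar vi %e EVar vQ) /e ECst 2)
       ^e ((EVar vi %e EVar vQ) %e ECst 2) *e (EVar vi /e EVar vQ))
  0 (Z.to_nat (Q * Q)) id f reg.
apply: hoare_weaken (fill _ _ _ _ _ _ _ _ _ _) _ _ => //; try by lia.
- by move=> q; rewrite /reg; lia.
- by move=> i q iL; rewrite /reg; lia.
- move=> i st' iL F xi Ii.
  have vQ' : var st' vQ = Q by rewrite (frame_var F).
  have iQ : 0 <= Z.of_nat i < Q * Q by lia.
  have bl := mod_limb (Z.of_nat i); have al := div_limb iQ.
  have Ei := Z.div_mod (Z.of_nat i) Q ltac:(lia).
  rewrite /= xi vQ' /f; move: bl al Ei.
  move: (Z.of_nat i mod Q) (Z.of_nat i / Q) => b a bl al Ei.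
  have h0 : 0 <= b / 2 by apply: Z.div_pos; case: bl; lia.
  have h1 : b / 2 <= b by apply: Z.div_le_upper_bound; case: bl; lia.
  have hr := Z.mod_pos_bound b 2 ltac:(lia).
  have tE : arr st' atab (Z.of_nat i - b + b / 2) = clmul a (b / 2).
    (* For [b > 0] the entry for [b / 2] lies earlier in the same table row. For [b = 0] it is the
       entry being computed, whose initial 0 is the right value. *)
    rewrite Ii /reg; case: (Z.eq_dec b 0) => [b0|b0].
      by rewrite b0 Z.div_0_l // Z.sub_0_r Z.add_0_r tab0; case: ifP => //; lia.
    have bb : b / 2 < b by apply: Z.div_lt; case: bl; lia.
    have -> : Z.of_nat i - b + b / 2 = b / 2 + a * Q by lia.
    case: ifP => [_|]; last by rewrite /limb in al bl; nia.
    rewrite /f Z.div_add ?Z.mod_add; try lia.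
    by rewrite Z.div_small ?Z.mod_small //; case: bl; lia.
  have hl : limb (b / 2) by case: bl => *; split; lia.
  have ml : limb (b mod 2 * a).
    have [->|->] : b mod 2 = 0 \/ b mod 2 = 1 by lia.
      by rewrite /limb; lia.
    by rewrite Z.mul_1_l.
  have bi : 0 <= b <= Z.of_nat i by case: bl; case: al; nia.
  have cm := clmul_limbs al bl.
  (* Doubling could seem to exceed the word range, but it is the product of [a] with [2 * (b / 2)],
     which is again a limb. *)
  have cB : 0 <= 2 * clmul a (b / 2) <= B.
    have hl2 : limb (2 * (b / 2)).
      by have := Z.mul_div_le b 2; case: bl => *; split; lia.
    by rewrite -clmul_double //; have := clmul_limbs al hl2; lia.
  rewrite tE -clmul_half; [|by case: al|by case: bl].
  split_ok; solve_range.
- move=> st' F E a b aQ bQ; have iab := table_index aQ bQ; rewrite E /reg /f.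
  case: ifP => [_|]; last by lia.
  rewrite Z.div_add_l; last by lia.
  by rewrite (Z.add_comm (a * Q)) Z.mod_add ?Z.div_small ?Z.mod_small ?Z.add_0_r //; lia.
Qed.

Lemma copy_spec st : (forall i, 3 <= i < 32 -> arr st ainp i = raw i) ->
  var st vi = 32 -> var st vX = X ->
  hoare W X raw st (CFor vi vX (CPut ainp (EVar vi) (ERaw (EVar vi))))
    (200 * (zn + zm) + 6)
    (fun st' => forall i, 3 <= i < X -> arr st' ainp i = raw i).
Proof.
move=> inp vi0 vXE; have [Q0 zn0 zk0 zL0 znL] := bounds.
pose reg (i : nat) q := (32 <=? q) && (q <? Z.of_nat i).
have fill := @hoare_fill W X raw st vi vX ainp (EVar vi) (ERaw (EVar vi))
  32 (Z.to_nat X) id raw reg.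
apply: hoare_weaken (fill _ _ _ _ _ _ _ _ _ _) _ _ => //; try by lia.
- by move=> q; rewrite /reg; lia.
- by move=> i q iL; rewrite /reg; lia.
- move=> i st' iL F xi Ii; rewrite /= xi; split_ok; solve_range.
- by move=> st' F E i iX; rewrite E /reg; case: ifP => // ?; apply: inp; lia.
Qed.

(** Guarantees that [n] doublings reach [Q]: minimality gives [4^(s-1) <= n], and
    [s - 1 < 2^(s-1)]. *)
Lemma half_size_le : (s <= n)%N.
Proof.
case: (posnP s) => [->//|s0]; have := Q_min (_ : s.-1 < s)%N; rewrite prednK // => /(_ (leqnn _)).
rewrite zpow2_nat zn_def; have := ltn_expl s.-1 (isT : 1 < 2)%N.
by set x := (2 ^ s.-1)%N => ? ?; nia.
Qed.

Lemma log_spec st : var st vn = zn -> var st vQ = 1 -> var st vi = 0 ->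
  hoare W X raw st
    (CFor vi vn (CSet vQ (EVar vQ +e EVar vQ *e (EVar vQ *e EVar vQ <e EVar vn +e ECst 1))))
    (100 * zn + 10) (fun st' => var st' vQ = Q).
Proof.
move=> vnE vQ1 vi0; have [Q0 zn0 zk0 zL0 znL] := bounds.
have QB : Q <= B by nia.
(* The minimum expresses that doubling stops by itself at exponent [s], while the loop keeps running
   up to [n]. *)
pose I (i : nat) st' := var st' vQ = 2 ^ Z.of_nat (minn i s).
apply: hoare_weaken (@hoare_for W X raw st vi vn _ 0 n (fun j => 60 * Z.of_nat j) I
  _ _ _ _ _ _ _ _ _ _) _ _ => //=; try lia.
- by rewrite /I min0n.
- move=> i st' iP F xi vQE; rewrite /I in vQE.
  have vn' : var st' vn = zn by rewrite (frame_var F).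
  have [si|si] := leqP s i.
    have E : 2 ^ Z.of_nat (minn i s) = Q by rewrite Q_def (minn_idPr si).
    have E' : 2 ^ Z.of_nat (minn i.+1 s) = Q by rewrite Q_def (minn_idPr (leqW si)).
    have c0 : (Q * Q <? zn + 1) = false by lia.
    apply: hoare_set; last by rewrite /=; lia.
      by rewrite /= vQE E vn' c0; split_ok; solve_range.
    by rewrite /I /= vQE E E' vn' c0; lia.
  have E : minn i s = i by apply/minn_idPl/ltnW.
  have E' : minn i.+1 s = i.+1 by apply/minn_idPl.
  have le := Q_min si; rewrite E in vQE.
  have c1 : (2 ^ Z.of_nat i * 2 ^ Z.of_nat i <? zn + 1) = true by lia.
  have p0 : 0 < 2 ^ Z.of_nat i by lia.
  have pn : 2 ^ Z.of_nat i <= zn by nia.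
  have znX : zn <= zn * zL by nia.
  apply: hoare_set; last by rewrite /=; lia.
    by rewrite /= vQE vn' c1; split_ok; solve_range.
  by rewrite /I /= vQE E' vn' c1 Nat2Z.inj_succ Z.pow_succ_r; lia.
- move=> st' F; rewrite /I => ->; rewrite Q_def; do 2!f_equal.
  exact/minn_idPr/half_size_le.
Qed.

Lemma setup_spec st : var st vn = zn -> var st vk = zk -> var st vX = X ->
  (forall i, 3 <= i < 32 -> arr st ainp i = raw i) ->
  (forall a i, (0 < a)%N -> arr st a i = 0) ->
  hoare W X raw st setup setup_time
    (fun st' => [/\ static st', forall a, (1 < a)%N -> arr st' a = arr st a
       & var st' vans = Z.b2z (k == 0)%N]).
Proof.
move=> vnE vkE vXE inp zero; have [Q0 zn0 zk0 zL0 znL] := bounds.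
apply: hoare_set_seq; first by rewrite /=; solve_range.
apply: hoare_seq (@copy_spec (set_var st vi 32) inp erefl vXE) _.
move=> st1 F1 inp1.
have vn1 : var st1 vn = zn by rewrite (frame_var F1).
have vk1 : var st1 vk = zk by rewrite (frame_var F1).
have kL : zk * zk <= zL by rewrite zL_def L_def; nia.
have kL' : 2 * (zk * zk) + 1 = zL by rewrite zL_def L_def; nia.
apply: hoare_set_seq; first by rewrite /=; split_ok; solve_range.
rewrite /= vk1.
apply: hoare_set_seq; first by rewrite /= vk1; split_ok; try solve_range; apply: small_in_range; nia.
rewrite /= vk1 kL'.
apply: hoare_set_seq; first by rewrite /= vn1; split_ok; solve_range.
rewrite /= vn1.
apply: hoare_set_seq; first by rewrite /=; solve_range.
apply: hoare_set_seq; first by rewrite /=; solve_range.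
set st2 := set_var _ vi _.
apply: hoare_seq (@log_spec st2 vn1 erefl erefl) _ => st3 F3 vQ3.
have QQ0 : 0 <= Q * Q by nia.
apply: hoare_set_seq; first by rewrite /= vQ3; split_ok; solve_range.
rewrite /= vQ3.
apply: hoare_set_seq; first by rewrite /=; solve_range.
set st4 := set_var _ vi _.
have tab4 q : arr st4 atab q = 0 by rewrite /= (frame_arr F3) //= (frame_arr F1) // zero.
apply: hoare_weaken (@table_spec st4 vQ3 erefl erefl tab4) _ _.
  by rewrite /setup_time /=; lia.
move=> st5 F5 tab5.
have inp5 : arr st5 ainp = arr st1 ainp by rewrite (frame_arr F5) //= (frame_arr F3).
split.
- split=> [||||||v vn|p pm|//]; try by rewrite (frame_var F5) //= ?(frame_var F3).
  + by rewrite (frame_var F5) //= (frame_var F3) //= (frame_var F1).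
  + by rewrite inp5 inp1 ?input_start //; lia.
  + by rewrite inp5 inp1 ?input_target //; lia.
- move=> a a1; rewrite (frame_arr F5) /=; last by rewrite mem_seq1; lia.
  by rewrite (frame_arr F3) //= (frame_arr F1) //= mem_seq1; lia.
- rewrite (frame_var F5) //= (frame_var F3) //= zk_def.
  by case: Z.ltb_spec; case: eqP => //; lia.
Qed.

Lemma program_body_spec st : var st vn = zn -> var st vk = zk -> var st vX = X ->
  (forall i, 3 <= i < 32 -> arr st ainp i = raw i) ->
  (forall a i, (0 < a)%N -> arr st a i = 0) ->
  hoare W X raw st program_body (setup_time + search_time)
    (fun st' => var st' vn = Z.b2z (has_kpath n k adj)).
Proof.
move=> vnE vkE vXE inp zero; have Q0 := Q_gt0.
apply: hoare_seq (setup_spec vnE vkE vXE inp zero) _ => st1 F1 [S1 off1 ans1].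
have zero1 a i : (1 < a)%N -> arr st1 a i = 0 by move=> a1; rewrite off1 // zero //; lia.
apply: hoare_weaken (search_spec S1 _ _ _ _ ans1) _ _ => //.
- by move=> a q aP; rewrite zero1 /limb; lia.
- by split; rewrite zero1.
- by move=> j jk; rewrite zero1.
- by apply/limbs_eq0 => i iL; rewrite zero1 //; lia.
- by lia.
Qed.

Lemma program_body_time :
  setup_time + search_time
  <= 2 ^ zk * 5000 * (zn + zm + 1) * ((zk + 1) * (zk + 1) * (zk + 1) * (zk + 1)).
Proof.
have [Q0 zn0 zk0 zL0 znL] := bounds; have QQ : Q * Q <= 4 * zn + 4 by rewrite Q_def; apply: sqr_pow2_le.
have zm0 : 0 <= zm by rewrite /zm; lia.
have p1 : 1 <= 2 ^ zk by have := Z.pow_pos_nonneg 2 zk; lia.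
have LK : 0 <= zL <= 2 * ((zk + 1) * (zk + 1)) by rewrite zL_def L_def; nia.
have w := walk_time_bound zn0 zm0 zk0 erefl erefl LK.
have r := round_time_bound zn0 zm0 zk0 erefl erefl LK w.
rewrite /setup_time /search_time.
apply: (total_time_bound zn0 zm0 zk0 erefl erefl LK _ p1 QQ).
by move: r; rewrite /round_time -/walk_time; lia.
Qed.

End Program.

(** * Input relocation and the final machine program *)

Section MachineProgram.
Local Open Scope Z_scope.

Lemma code_step_store W a s l M : 0 <= M a -> in_range W (M s) ->
  code_step W (IStore a s :: l) M = code_step W l (upd M (Z.to_nat (M a)) (M s)).
Proof.
move=> /Z.leb_le a0 sW; rewrite /= /instr_step /step /= a0 in_wordP //.
Qed.

(* The input overlaps the cells 4..31 used as variables and temporaries; only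
   0..3 are free (cell 3 holds the first start index, 0).  The prologue saves
   cells 4..31 as entries 4..31 of array 0, walking the address in cell 1 from
   X + 32 to X + 248, and leaves X = n + m + 32 in cell 3. *)
Definition save_cells (j : nat) (c : nat) : seq instr :=
  flatten [seq [:: IAdd 1 1 3; IStore 1 i] | i <- iota j c].

Definition prologue : seq instr :=
  [:: IConst 3 32; IAdd 1 0 1; IAdd 1 1 3; IConst 3 24; IAdd 1 1 3; IConst 3 8]
  ++ save_cells 4 28 ++ [:: IConst 3 248; ISub 3 1 3].

Definition program : seq instr :=
  prologue ++ cmd_code (size prologue) program_body ++ [:: IHalt].

Lemma straight_prologue : all straight prologue.
Proof. by vm_compute. Qed.

Local Arguments code_step : simpl never.

Section Prologue.
Variables (n m : nat) (W : Z) (M0 : nat -> Z).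
Let x := (n + m + 32)%N.
Hypothesis xW : Z.of_nat x + 300 <= W.

(** Since [x >= 32], all destinations lie above the cells being saved, so no source is overwritten
    before it is read. *)
Lemma save_cells_correct c j M : (4 <= j)%N -> (j + c <= 32)%N ->
  (forall i, in_range W (M i)) -> M 3%N = 8 -> M 1%N = Z.of_nat (x + 8 * j - 8) ->
  exists M', [/\ code_step W (save_cells j c) M = Some M',
     forall i, in_range W (M' i), M' 1%N = Z.of_nat (x + 8 * (j + c) - 8),
     forall y, y != 1%N -> (forall i, (j <= i < j + c)%N -> y <> x + 8 * i)%N -> M' y = M y
   & forall i, (j <= i < j + c)%N -> M' (x + 8 * i)%N = M i].
Proof.
have bin := @code_step_bin W 32 ltac:(lia) (Z.le_refl 32).
elim: c j M => [|c IH] j M j4 jc MW M3 M1.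
  exists M; split=> //; first by rewrite addn0.
  by move=> i; lia.
have sum : M 1%N + M 3%N = Z.of_nat (x + 8 * j) by rewrite M1 M3; lia.
have sumW : in_range W (M 1%N + M 3%N) by rewrite sum /in_range; lia.
pose M1' := upd M 1 (M 1%N + M 3%N).
pose M2' := upd M1' (x + 8 * j) (M j).
have M2W i : in_range W (M2' i) by do !apply: upd_in_range.
have M2old y : y != 1%N -> (y <> x + 8 * j)%N -> M2' y = M y.
  by move=> y1 yj; rewrite /M2' /M1' !updE; case: eqP => // _; rewrite (negbTE y1).
have [||||M' [E' W' V1 old new]] := IH j.+1 M2' _ _ M2W; try lia.
- by rewrite M2old //; lia.
- rewrite /M2' updE; case: eqP => [|_]; first by lia.
  by rewrite /M1' updE eqxx sum; lia.
exists M'; split=> //.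
- rewrite -[save_cells _ _]/[:: IAdd 1 1 3, IStore 1 j & save_cells j.+1 c].
  rewrite (bin OAdd) // -/M1' code_step_store.
  + have -> : M1' j = M j by rewrite /M1' updE; case: eqP => //; lia.
    have -> : Z.to_nat (M1' 1%N) = (x + 8 * j)%N by rewrite /M1' updE eqxx sum; lia.
    exact: E'.
  + by rewrite /M1' updE eqxx sum; lia.
  + exact: upd_in_range.
- by rewrite V1; f_equal; lia.
- move=> y y1 yP; rewrite old //; last by move=> i iP; apply: yP; lia.
  by rewrite M2old //; apply: yP; lia.
- move=> i iP; case: (eqVneq i j) => [->|ij].
    rewrite old; [|lia|by move=> i' ?; lia].
    by rewrite /M2' updE eqxx.
  rewrite new; last by lia.
  by rewrite M2old //; lia.
Qed.

Lemma prologue_correct : (forall i, in_range W (M0 i)) ->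
  M0 0%N = Z.of_nat n -> M0 1%N = Z.of_nat m ->
  exists M', [/\ code_step W prologue M0 = Some M', forall i, in_range W (M' i),
     M' 3%N = Z.of_nat x,
     forall y, y != 1%N -> y != 3%N ->
       (forall i, (4 <= i < 32)%N -> y <> x + 8 * i)%N -> M' y = M0 y
   & forall i, (4 <= i < 32)%N -> M' (x + 8 * i)%N = M0 i].
Proof.
move=> MW M0n M0m.
have r z : 0 <= z <= Z.of_nat x + 300 -> in_range W z by rewrite /in_range; lia.
pose M1 := upd (upd (upd (upd (upd (upd M0 3 32) 1 (Z.of_nat (n + m))) 1
  (Z.of_nat x)) 3 24) 1 (Z.of_nat (x + 24))) 3 8.
have M1W i : in_range W (M1 i).
  by rewrite /M1; do 6!(apply: upd_in_range; last by apply: r; lia).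
have M1old y : y != 1%N -> y != 3%N -> M1 y = M0 y.
  by move=> y1 y3; rewrite /M1 !updE (negbTE y1) (negbTE y3).
have bin := @code_step_bin W 32 ltac:(lia) (Z.le_refl 32).
have [||M2 [E2 W2 V2 old new]] := @save_cells_correct 28 4 M1 isT isT M1W.
- by rewrite /M1 !updE.
- by rewrite /M1 !updE /=; lia.
exists (upd (upd M2 3 248) 3 (Z.of_nat x)); split.
- rewrite /prologue code_step_cat.
  have -> : code_step W [:: IConst 3 32; IAdd 1 0 1; IAdd 1 1 3; IConst 3 24; IAdd 1 1 3;
      IConst 3 8] M0 = Some M1.
    rewrite code_step_const; last by apply: r; lia.
    have sum1 : upd M0 3 32 0%N + upd M0 3 32 1%N = Z.of_nat (n + m).
      by rewrite !updE /= M0n M0m; lia.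
    rewrite (bin OAdd) /= sum1; last by apply: r; lia.
    set M1a := upd (upd _ _ _) 1 _.
    have sum2 : M1a 1%N + M1a 3%N = Z.of_nat x by rewrite /M1a !updE /=; lia.
    rewrite (bin OAdd) /= sum2; last by apply: r; lia.
    rewrite code_step_const; last by apply: r; lia.
    set M1b := upd (upd M1a _ _) 3 24.
    have sum3 : M1b 1%N + M1b 3%N = Z.of_nat (x + 24) by rewrite /M1b !updE /=; lia.
    rewrite (bin OAdd) /= sum3; last by apply: r; lia.
    by rewrite code_step_const; last by apply: r; lia.
  rewrite -[obind _ _]/(code_step W _ M1) code_step_cat E2.
  rewrite -[obind _ _]/(code_step W _ M2) code_step_const; last by apply: r; lia.
  have diff : upd M2 3 248 1%N - upd M2 3 248 3%N = Z.of_nat x.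
    by rewrite !updE /= V2; lia.
  by rewrite (bin OSub) /= diff; last by apply: r; lia.
- by do !apply: upd_in_range => //; apply: r; lia.
- by rewrite !updE.
- by move=> y y1 y3 yP; rewrite !updE (negbTE y3) old // M1old.
- move=> i iP; rewrite !updE; case: eqP => [|_]; first by lia.
  by rewrite new // M1old //; lia.
Qed.
End Prologue.

Lemma input_mem_range n k adj i : adj_wf n adj -> (k <= n)%N ->
  0 <= input_mem n k adj i <= Z.of_nat (n + num_edges adj).
Proof.
move=> wf kn; rewrite /input_mem; do !case: ifP => _; try lia.
  suff : (sumn (map size (take (i - 3) adj)) <= num_edges adj)%N by lia.
  exact: take_adj_le erefl _.
suff : (nth 0%N (flatten adj) (i - (4 + n)) <= n)%N by lia.
have [si|si] := leqP (size (flatten adj)) (i - (4 + n)); first by rewrite nth_default.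
have /flattenP[l /(allP (proj2 (andP wf)))/andP[_ /allP H] il] := mem_nth 0%N si.
exact/ltnW/H.
Qed.

Lemma input_mem_out n k adj (i : nat) : (n + num_edges adj + 4 <= i)%N ->
  input_mem n k adj i = 0.
Proof.
move=> ni; rewrite /input_mem.
have -> : (i == 0)%N = false by lia.
have -> : (i == 1)%N = false by lia.
have -> : (i == 2)%N = false by lia.
have -> : ((3 <= i) && (i <= 3 + n))%N = false by lia.
by have -> : ((4 + n <= i) && (i < 4 + n + num_edges adj))%N = false by lia.
Qed.

(** Negative indices and arrays from 8 on have no cells; the default 0 lets all arrays other than
    the input copy be entirely zero. *)
Definition initial_state (X : Z) (M : nat -> Z) : state :=
  State M (fun a i => if (i <? 0) || (8 <= a)%N then 0
                      else M (Z.to_nat (X + 8 * i + Z.of_nat a))).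

Lemma exists_half_size (n : nat) : exists2 s : nat,
  Z.of_nat n < 2 ^ Z.of_nat s * 2 ^ Z.of_nat s
  & forall j : nat, (j < s)%N -> 2 ^ Z.of_nat j * 2 ^ Z.of_nat j <= Z.of_nat n.
Proof.
have ex : exists s, (n < 2 ^ s * 2 ^ s)%N.
  by exists n; have := ltn_expl n (isT : 1 < 2)%N; nia.
exists (ex_minn ex); case: ex_minnP => s sP smin; first by rewrite zpow2_nat; lia.
move=> j js; rewrite zpow2_nat; have [le|/smin] := leqP (2 ^ j * 2 ^ j) n; lia.
Qed.

(** The largest index is of order [n * L], cubic in [S] because [k <= n], and interleaving
    multiplies it by 8. In [S^6 = S^3 * S^3] one factor [S^3] already supplies the constant 64, as
    [S >= 4]. *)
Lemma word_bound n m k L Q B S W : 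
  S = n + m + 4 -> 0 <= n -> 0 <= m -> 0 <= k <= n -> L = 2 * (k * k) + 1 ->
  0 < Q -> Q * Q <= 4 * n + 4 -> B = n * L + L + Q * Q + (n + m + 32) + k + 10 ->
  W = S * S * S * S * S * S -> n + m + 32 + 8 * B + 8 <= W /\ n + m + 332 <= W.
Proof.
move=> SE n0 m0 kn LE Q0 QE BE WE.
have kk : k * k <= n * n by nia.
have nk : n * (k * k) <= n * (n * n) by apply: Z.mul_le_mono_nonneg_l; lia.
have S4 : 4 <= S by lia.
have n2 : n * n <= S * S by nia.
have n3 : n * (n * n) <= S * (S * S) by apply: Z.mul_le_mono_nonneg; lia.
have S2 : 4 * S <= S * S by nia.
have S3 : 4 * (S * S) <= S * (S * S) by nia.
have S6 : 64 * (S * (S * S)) <= W.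
  rewrite WE; have -> : S * S * S * S * S * S = (S * (S * S)) * (S * (S * S)) by ring.
  by apply: Z.mul_le_mono_nonneg_r; lia.
by split; nia.
Qed.

Lemma program_correct n k adj : adj_wf n adj -> (k <= n)%N ->
  (num_kpaths n k adj <= 1)%N ->
  decides_within (Z.of_nat ((n + num_edges adj + 4) ^ 6)) program n k adj
    (has_kpath n k adj) (60 * 100 * 2 ^ k * (n + num_edges adj + 1) * (k + 1) ^ 4).
Proof.
move=> wf kn one; set m := num_edges adj; set M0 := input_mem n k adj.
have [s nQ Qmin] := exists_half_size n; set Q := 2 ^ Z.of_nat s in nQ.
pose L := (2 * k * k + 1)%N; pose x := (n + m + 32)%N; pose X := Z.of_nat x.
pose zn := Z.of_nat n; pose zk := Z.of_nat k; pose zL := Z.of_nat L.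
pose B := zn * zL + zL + Q * Q + X + zk + 10.
have Q0 : 0 < Q by rewrite /Q; lia.
have L0 : (0 < L)%N by rewrite /L; lia.
have XE : X = zn + Z.of_nat m + 32 by rewrite /X /x /zn; lia.
set W := Z.of_nat _.
have QQ : Q * Q <= 4 * zn + 4.
  by apply: sqr_pow2_le => //; rewrite /zn; lia.
have WE : W = (zn + Z.of_nat m + 4) * (zn + Z.of_nat m + 4) * (zn + Z.of_nat m + 4)
    * (zn + Z.of_nat m + 4) * (zn + Z.of_nat m + 4) * (zn + Z.of_nat m + 4).
  by rewrite /W /zn !expnS expn0; lia.
have [XW xW] := @word_bound zn (Z.of_nat m) zk zL Q B _ W erefl ltac:(lia) ltac:(lia)
  ltac:(lia) ltac:(rewrite /zL /L /zk; lia) Q0 QQ ltac:(rewrite /B; lia) WE.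
rewrite -XE in XW.
have M0W i : in_range W (M0 i).
  have := @input_mem_range n k adj i wf kn; rewrite /in_range -/M0; lia.
have [M1 [E1 W1 V1 old new]] : exists M', [/\ code_step W prologue M0 = Some M',
     forall i, in_range W (M' i), M' 3%N = Z.of_nat x,
     forall y, y != 1%N -> y != 3%N ->
       (forall i, (4 <= i < 32)%N -> y <> x + 8 * i)%N -> M' y = M0 y
   & forall i, (4 <= i < 32)%N -> M' (x + 8 * i)%N = M0 i].
  by apply: prologue_correct => //; rewrite -/x; lia.
pose st := initial_state X M1.
have zero y : (x <= y)%N -> M0 y = 0 by move=> xy; apply: input_mem_out; rewrite -/m; lia.
have inp i : 3 <= i < 32 -> arr st 0 i = input n k adj i.
  move=> iP; rewrite /st /=; have -> : (i <? 0) = false by lia.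
  rewrite /= /input -/M0; case: (Z.eq_dec i 3) => [->|i3].
    (* Cell 3 is overwritten by the prologue without being saved. It held the start of the first
       list, which is 0, as is the untouched cell of this array entry. *)
    have -> : Z.to_nat (X + 8 * 3 + Z.of_nat 0) = (x + 24)%N by lia.
    have -> : M1 (x + 24)%N = 0 by rewrite old ?zero; lia.
    by rewrite /M0 /input_mem /= subnn take0.
  have -> : Z.to_nat (X + 8 * i + Z.of_nat 0) = (x + 8 * Z.to_nat i)%N by lia.
  by apply: new; lia.
have arr0 a i : (0 < a)%N -> arr st a i = 0.
  move=> a0; rewrite /st /=; case: ifP => // iP.
  have -> : Z.to_nat (X + 8 * i + Z.of_nat a) = (x + 8 * Z.to_nat i + a)%N by lia.
  by rewrite old; [apply: zero; lia | lia | lia | move=> i' ?; lia].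
have rep : represents W X (input n k adj) st M1.
  split=> //.
  - by move=> j jR jX; rewrite /input Nat2Z.id -/M0 old; [ | lia | lia | move=> i' ?; lia].
  - by move=> a i a8 i0; rewrite /st /=; have -> : (i <? 0) || (8 <= a)%N = false by lia.
have st0 : var st 0 = zn by rewrite /st /= old; [ | | | move=> i' ?; lia].
have st2 : var st 2 = zk by rewrite /st /= old; [ | | | move=> i' ?; lia].
have st3 : var st 3 = X by rewrite /st /= V1.
have [t [st' [ex tT out]]] := program_body_spec erefl erefl erefl erefl L0
  nQ XE erefl XW wf erefl kn erefl one Qmin st0 st2 st3 inp arr0.
have RX : 32 <= X by lia.
have XW8 : X + 8 <= W by rewrite /B in XW; lia.
have [M2 [R2 rep2]] := cmd_code_correct XW8 RX ex program_body_wf (erefl program) rep.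
exists (size prologue + t)%N; split.
  have time := program_body_time (Q := Q) erefl erefl erefl erefl L0 nQ XE wf erefl kn erefl one Qmin.
  have {time tT} := Z.le_trans _ _ _ tT time.
  (* The steps of the prologue are absorbed by the gap between the constant 5000 of the body and
     [60 * 100]. *)
  have -> : size prologue = 64%N by [].
  rewrite zpow2_nat !expnS expn0 -/m; have := expn_gt0 2 k.
  move: (2 ^ k)%N => p /= p0 tT.
  have N0 : (0 < p * (n + m + 1) * ((k + 1) * (k + 1) * (k + 1) * (k + 1)))%N.
    by rewrite !muln_gt0 p0 !addn1.
  by lia.
exists (Config (size prologue + size (cmd_code (size prologue) program_body)) M2); split.
  rewrite run_add.
  by rewrite (@run_code W prologue program [::] _ _ _ straight_prologue erefl E1).
split.
  rewrite /halted /program catA -[pc _]/(size prologue + size (cmd_code _ _))%N -size_cat.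
  by rewrite nth_cat ltnn subnn cats1 size_rcons ltnSn.
by rewrite -[Defs.mem _ _]/(M2 0%N); case: rep2 => /(_ 0%N isT) -> _ _ _ _; rewrite out; case: has_kpath.
Qed.

End MachineProgram.

Theorem theorem6 :
  exists (P : seq instr) (e C d : nat),
    forall (n k : nat) (adj : seq (seq nat)),
      adj_wf n adj ->
      k <= n ->
      num_kpaths n k adj <= 1 ->
      decides_within (Z.of_nat ((n + num_edges adj + 4) ^ e)) P n k adj
        (has_kpath n k adj)
        (C * 2 ^ k * (n + num_edges adj + 1) * (k + 1) ^ d).
Proof.
exists program, 6, (60 * 100), 4 => n k adj wf kn one.
exact: program_correct.
Qed.
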